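(* Consider the renewal system and the iterative algorithm described in the context, run with stepsizes $\eta[k]=\frac{1}{(k+2)T_{min}}$ for all $k\in\{0,1,2,\ldots\}$. Then with probability 1, $$\lim_{K\to\infty}\frac{\sum_{k=0}^{K-1}R[k]}{\sum_{k=0}^{K-1}T[k]}=\theta^*.$$
   Context: System: $\{S[k]\}_{k=0}^\infty$ is an i.i.d. sequence of random vectors with values in $\Omega_S\subseteq\mathbb{R}^m$. For each $s\in\Omega_S$, $\mathcal{D}(s)$ is a compact subset of $(0,\infty)\times(-\infty,\infty)$. On each frame $k\in\{0,1,2,\ldots\}$ a decision $(T[k],R[k])\in\mathcal{D}(S[k])$ is chosen; $T[k]$ and $R[k]$ are random variables (measurable). There are functions $L,M:\Omega_S\to[0,\infty)$ with $t\ge L(s)$ and $t^2+r^2\le M(s)$ for all $(t,r)\in\mathcal{D}(s)$, $s\in\Omega_S$, such that $L(S[0]),M(S[0])$ are random variables with $\mathbb{E}[L(S[0])]>0$ and $\mathbb{E}[M(S[0])]<\infty$. Consequently there are constants $T_{min}>0$, $T_{max}$, $R_{min}$, $R_{max}$, $C_1$, $C_2$ (fixed throughout) such that, regardless of how decisions are made, for all $k$: $T_{min}\le\mathbb{E}[T[k]]\le T_{max}$, $R_{min}\le\mathbb{E}[R[k]]\le R_{max}$, $\mathbb{E}[T[k]^2]\le C_1$, $\mathbb{E}[R[k]^2]\le C_2$. Optimal ratio: $\mathcal{A}\subseteq\mathbb{R}^2$ is the set of all one-shot expectations $(\mathbb{E}[T[0]],\mathbb{E}[R[0]])$ achievable on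 frame $0$ over all (measurable, possibly randomized) conditional distributions for choosing $(T[0],R[0])\in\mathcal{D}(S[0])$ given $S[0]$; $\overline{\mathcal{A}}$ is its closure. $\theta^*=\sup_{(t,r)\in\overline{\mathcal{A}}}\{r/t\}$. The finite constants $\theta_{min},\theta_{max}$ satisfy $\theta_{min}\le\theta^*\le\theta_{max}$. Algorithm: given an arbitrary deterministic $\theta[0]\in[\theta_{min},\theta_{max}]$ and deterministic positive stepsizes $\{\eta[k]\}$, on each frame $k$: observe $S[k]$ and $\theta[k]$; choose $(T[k],R[k])\in\mathcal{D}(S[k])$ to maximize $R[k]-\theta[k]T[k]$ (ties broken by an arbitrary rule making $(T[k],R[k])$ a measurable function of $(\theta[k],S[k])$); then update $\theta[k+1]=\big[\theta[k]+\eta[k](R[k]-\theta[k]T[k])\big]_{\theta_{min}}^{\theta_{max}}$, where $[x]_{\theta_{min}}^{\theta_{max}}$ is the projection of $x$ onto $[\theta_{min},\theta_{max}]$. *)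

(* Defs.v *)
From HB Require Import structures.
From mathcomp Require Import all_boot all_order all_algebra.
From mathcomp Require Import all_classical all_reals all_analysis.

Set Implicit Arguments.
Unset Strict Implicit.
Unset Printing Implicit Defensive.

Import Order.TTheory GRing.Theory Num.Theory.
Import numFieldNormedType.Exports.

Local Open Scope classical_set_scope.
Local Open Scope ring_scope.

(* A subset A of a measurable space, as a type with the trace sigma-algebra
   { A `&` B | B measurable }; A itself need not be measurable. The
   nonemptiness proof is there because the library's measurable types are
   pointed. *)
Definition trace_space d (T : measurableType d) (A : set T) (A0 : A !=set0)
  : Type := set_type A.

Section trace_space.
Context d (T : measurableType d) (A : set T) (A0 : A !=set0).

Let base_point : trace_space A0 :=
  exist _ (sval (cid A0)) (mem_set (svalP (cid A0))).

HB.instance Definition _ := Choice.copy (trace_space A0) (set_type A).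
HB.instance Definition _ := isPointed.Build (trace_space A0) base_point.

Definition trace_val (x : trace_space A0) : T := sval x.

Definition trace_measurable : set (set (trace_space A0)) :=
  preimage_set_system setT trace_val measurable.

Let trace_sigma_algebra : sigma_algebra setT trace_measurable.
Proof.
apply: sigma_algebra_preimage; split.
- exact: measurable0.
- by move=> B mB; rewrite setTD; exact: measurableC.
- by move=> F mF; exact: bigcupT_measurable.
Qed.

Let trace_measurable0 : trace_measurable set0.
Proof. by have [] := trace_sigma_algebra. Qed.

Let trace_measurableC B : trace_measurable B -> trace_measurable (~` B).
Proof. by have [_ + _] := trace_sigma_algebra => /[apply]; rewrite setTD. Qed.

Let trace_measurable_bigcup (F : (set (trace_space A0))^nat) :
  (forall i, trace_measurable (F i)) -> trace_measurable (\bigcup_i F i).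
Proof. by have [_ _] := trace_sigma_algebra; exact. Qed.

HB.instance Definition _ := @isMeasurable.Build (preimage_display trace_val)
  (trace_space A0) trace_measurable trace_measurable0 trace_measurableC
  trace_measurable_bigcup.

End trace_space.

Section renewal.
Context d dX (Omega : measurableType d) (X : measurableType dX) (R : realType).
Variable P : probability Omega R.

Definition mutually_independent (S : nat -> Omega -> X) : Prop :=
  forall (J : seq nat) (B : nat -> set X), uniq J ->
    (forall j, measurable (B j)) ->
    P (\big[setI/setT]_(j <- J) (S j @^-1` B j))
      = (\prod_(j <- J) P (S j @^-1` B j))%E.

Definition identically_distributed (S : nat -> Omega -> X) : Prop :=
  forall (k : nat) (B : set X), measurable B ->
    P (S k @^-1` B) = P (S 0%N @^-1` B).

Definition iid (S : nat -> Omega -> X) : Prop :=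
  [/\ forall k, measurable_fun setT (S k),
      mutually_independent S & identically_distributed S].

(* Points of R * R are pairs (task duration t, reward r). *)
Definition decision_sets (D : X -> set (R * R)) : Prop :=
  forall s, compact (D s) /\ D s `<=` [set p | 0 < p.1].

Definition moment_envelope (S0 : Omega -> X) (D : X -> set (R * R))
    (L M : X -> R) : Prop :=
  [/\ forall s, 0 <= L s /\ 0 <= M s,
      forall s p, D s p -> L s <= p.1 /\ p.1 ^+ 2 + p.2 ^+ 2 <= M s,
      measurable_fun setT (L \o S0) /\ measurable_fun setT (M \o S0),
      (0 < 'E_P[L \o S0])%E
    & ('E_P[M \o S0] < +oo)%E].

(* No causality is asked of (T, Rw): it ranges over all random pairs that are
   feasible on the frame in state Sk. *)
Definition feasible (D : X -> set (R * R)) (Sk : Omega -> X)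
    (T Rw : Omega -> R) : Prop :=
  [/\ measurable_fun setT T, measurable_fun setT Rw
    & forall w, D (Sk w) (T w, Rw w)].

Definition uniform_bounds (S : nat -> Omega -> X) (D : X -> set (R * R))
    (Tmin Tmax Rmin Rmax C1 C2 : R) : Prop :=
  forall (k : nat) (T Rw : Omega -> R), feasible D (S k) T Rw ->
    [/\ (Tmin%:E <= 'E_P[T] <= Tmax%:E)%E,
        (Rmin%:E <= 'E_P[Rw] <= Rmax%:E)%E,
        ('E_P[(fun w => T w ^+ 2)%R] <= C1%:E)%E
      & ('E_P[(fun w => Rw w ^+ 2)%R] <= C2%:E)%E].

(* kappa s is the conditional law of (T[0], R[0]) given S[0] = s. *)
Definition one_shot_expectations (S0 : Omega -> X) (D : X -> set (R * R))
  : set (R * R) :=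
  [set p | exists kappa : R.-pker X ~> (R * R)%type,
    [/\ forall s, kappa s (D s) = 1%E,
        (p.1)%:E = (\int[P]_w \int[kappa (S0 w)]_z (z.1)%:E)%E
      & (p.2)%:E = (\int[P]_w \int[kappa (S0 w)]_z (z.2)%:E)%E]].

Definition optimal_ratio (S0 : Omega -> X) (D : X -> set (R * R)) : R :=
  sup [set p.2 / p.1 | p in closure (one_shot_expectations S0 D)].

Definition proj_itv (a b x : R) : R := Num.max a (Num.min x b).

Lemma proj_itv_in (a b x : R) : a <= b -> a <= proj_itv a b x <= b.
Proof. by move=> ab; rewrite /proj_itv le_max lexx ge_max ab ge_min lexx orbT. Qed.

Lemma proj_itv_nearest (a b x z : R) : a <= z <= b ->
  `|x - proj_itv a b x| <= `|x - z|.
Proof.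
move=> /andP[az zb]; rewrite /proj_itv minEle maxEle.
have [xb|bx] := leP x b.
  have [ax|xa] := leP a x; first by rewrite subrr normr0.
  have xz : x <= z by rewrite ltW// (lt_le_trans xa).
  by rewrite distrC (distrC x) !ger0_norm ?subr_ge0// ?(ltW xa)// lerD2r.
have zx : z <= x by rewrite ltW// (le_lt_trans zb).
by rewrite (le_trans az zb) !ger0_norm ?subr_ge0// ?(ltW bx)// lerD2l lerN2.
Qed.

(* f (theta, s) is the decision taken in state s with current estimate theta;
   the choice of f among the maximizers is the tie-breaking rule. *)
Definition maximizing_rule (thmin thmax : R) (D : X -> set (R * R))
    (f : R * X -> R * R) : Prop :=
  measurable_fun ([set` `[thmin, thmax]] `*` setT) f /\
  forall theta s, thmin <= theta <= thmax ->
    D s (f (theta, s)) /\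
    forall p, D s p ->
      p.2 - theta * p.1 <= (f (theta, s)).2 - theta * (f (theta, s)).1.

Definition algorithm_run (thmin thmax theta0 : R) (eta : nat -> R)
    (S : nat -> Omega -> X) (f : nat -> R * X -> R * R)
    (theta T Rw : nat -> Omega -> R) : Prop :=
  [/\ forall w, theta 0%N w = theta0,
      forall k w, (T k w, Rw k w) = f k (theta k w, S k w)
    & forall k w, theta k.+1 w =
        proj_itv thmin thmax
          (theta k w + eta k * (Rw k w - theta k w * T k w))].

End renewal.

(* Main.v *)
(* For z in [thmin, thmax] let v(z) be the mean over the state s of
   max {r - z t | (t, r) in D s}.  The optimal ratio rho is the zero of v, and v
   decreases with slope at most - Tmin.  The state S[k] is independent of
   theta[k], so theta[k] - rho is driven by the drift v(theta[k]), and the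
   stepsizes 1 / ((k + 2) Tmin) give E[(theta[k] - rho)^2] = O(1 / k).
   The conditional mean of R[k] - rho T[k] is O(|theta[k] - rho|) and that of
   Tmin - T[k] is at most 0.  If the partial sums sigma[K] of w[k] have such a
   one-sided conditional drift, expanding the square of their positive part
   gives E[max(sigma[K], 0)^2] = O(K), hence max(sigma[K], 0) / K -> 0 almost
   surely: along squares by summability of expectations, and in between because
   the increments are bounded in mean square.  Applying this to w = R - rho T,
   its opposite, and Tmin - T yields the limit of the ratio; almost sure
   convergence of theta[k] is not needed. *)

Require Import Defs.
From HB Require Import structures.
From mathcomp Require Import all_boot all_order all_algebra.
From mathcomp Require Import all_classical all_reals all_analysis.
From mathcomp Require Import measurable_realfun.
From mathcomp Require Import ring lra zify.

Set Implicit Arguments.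
Unset Strict Implicit.
Unset Printing Implicit Defensive.

Import Order.TTheory GRing.Theory Num.Theory.
Import numFieldNormedType.Exports.

Local Open Scope classical_set_scope.
Local Open Scope ring_scope.

(** * Independence of the state from the past *)

(** Measurable rectangles are stable under intersection and generate the product sigma-algebra, so a
    finite measure is determined by its values on them. *)
Lemma rectangle_measure_unique d1 d2 (Y : measurableType d1)
    (X : measurableType d2) (R : realType)
    (m1 m2 : {measure set (Y * X) -> \bar R}) :
  (m1 setT < +oo)%E ->
  (forall A B, measurable A -> measurable B ->
    m1 (A `*` B) = m2 (A `*` B)) ->
  forall C, measurable C -> m1 C = m2 C.
Proof.
move=> m1oo m12 C mC.
apply: (measure_unique [set A `*` B | A in measurable & B in measurable]
  (fun=> setT)) => //.
- exact: measurable_prod_measurableType.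
- move=> _ _ [A1 mA1 [B1 mB1 <-]] [A2 mA2 [B2 mB2 <-]].
  exists (A1 `&` A2); first exact: measurableI.
  by exists (B1 `&` B2); [exact: measurableI|rewrite setXI].
- by move=> _; exists setT => //; exists setT => //; rewrite setXTT.
- by rewrite bigcup_const.
- by move=> _ [A mA [B mB <-]]; exact: m12.
Qed.

Section independence.
Context d dX dY (Omega : measurableType d) (X : measurableType dX)
  (Y : measurableType dY) (R : realType) (P : probability Omega R).

Definition indep_rv (Z : Omega -> Y) (S : Omega -> X) :=
  forall A B, measurable A -> measurable B ->
    P (Z @^-1` A `&` S @^-1` B) = (P (Z @^-1` A) * P (S @^-1` B))%E.

Let cyl (S : nat -> Omega -> X) (B : nat -> set X) (J : seq nat) :=
  \big[setI/setT]_(j <- J) (S j @^-1` B j).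

(** [Z k] depends only on the states before [k]. Instead of describing the sigma-algebra of the
    past, the proof carries independence along the recursion. *)
Lemma recursion_indep (S : nat -> Omega -> X) (Z : nat -> Omega -> Y)
    (psi : nat -> Y * X -> Y) (z0 : Y) :
  (forall k, measurable_fun setT (S k)) -> mutually_independent P S ->
  (forall k, measurable_fun setT (psi k)) ->
  (forall w, Z 0%N w = z0) ->
  (forall k w, Z k.+1 w = psi k (Z k w, S k w)) ->
  forall k, measurable_fun setT (Z k) /\ indep_rv (Z k) (S k).
Proof.
move=> mS iS mpsi Z0 ZS k.
have mcyl B J : (forall j, measurable (B j)) -> measurable (cyl S B J).
  move=> mB; rewrite /cyl; elim: J => [|j J IH]; first by rewrite big_nil.
  rewrite big_cons; apply: measurableI => //.
  by rewrite -[X in measurable X]setTI; exact: mS.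
(* The induction needs [Z k] independent of every event on finitely many states with indices at
   least [k]: passing to [k.+1] spends the index [k] and keeps the later ones. *)
suff main : measurable_fun setT (Z k) /\ forall J B A, uniq J ->
    all (leq k) J -> measurable A -> (forall j, measurable (B j)) ->
    P (Z k @^-1` A `&` cyl S B J) = (P (Z k @^-1` A) * P (cyl S B J))%E.
  have [mZ iZ] := main; split=> // A B mA mB.
  have := iZ [:: k] (fun=> B) A; rewrite /cyl !big_seq1; apply => //=.
  by rewrite leqnn.
elim: k => [|k [mZ IH]].
  have -> : Z 0%N = cst z0 by exact/funext.
  split; first exact: measurable_cst.
  move=> J B A _ _ _ _; rewrite preimage_cst; case: ifPn => _.
    by rewrite setTI probability_setT mul1e.
  by rewrite set0I measure0 mul0e.
have mp : measurable_fun setT (fun w => (Z k w, S k w)).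
  exact: measurable_fun_pair.
have ZSE : Z k.+1 = psi k \o (fun w => (Z k w, S k w)) by exact/funext/ZS.
split; first by rewrite ZSE; exact: measurableT_comp.
move=> J B A uJ kJ mA mB; set E := cyl S B J.
have mE : measurable E by exact: mcyl.
(* On rectangles the condition on [S k] joins the later ones: [B2] is [B] with [B'] placed at [k],
   an index absent from [J]. The induction hypothesis is used for [k :: J] and for [[:: k]]. *)
have rect A' B' : measurable A' -> measurable B' ->
    P (Z k @^-1` A' `&` S k @^-1` B' `&` E) =
    (P (Z k @^-1` A' `&` S k @^-1` B') * P E)%E.
  move=> mA' mB'; pose B2 j := if j == k then B' else B j.
  have mB2 j : measurable (B2 j) by rewrite /B2; case: ifP.
  have kJn : k \notin J.
    by apply/negP => /(allP kJ); rewrite ltnn.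
  have EB2 : cyl S B2 J = E.
    rewrite /E /cyl [LHS]big_seq [RHS]big_seq; apply: eq_bigr => j jJ.
    by rewrite /B2; case: eqP => // jk; move: kJn; rewrite -jk jJ.
  have ukJ : uniq (k :: J) by rewrite /= kJn.
  have akJ : all (leq k) (k :: J).
    rewrite /= leqnn; apply/allP => j /(allP kJ); exact: ltnW.
  have EkJ : cyl S B2 (k :: J) = S k @^-1` B' `&` E.
    by rewrite -EB2 /cyl big_cons {1}/B2 eqxx.
  have := IH (k :: J) B2 A' ukJ akJ mA' mB2.
  rewrite EkJ setIA => ->.
  have := IH [:: k] B2 A' isT; rewrite /= leqnn => /(_ isT mA' mB2).
  rewrite {1 2}/cyl !big_seq1 {1 2}/B2 eqxx => ->.
  rewrite -muleA; congr (_ * _)%E.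
  have := iS (k :: J) B2 ukJ mB2; rewrite -/(cyl S B2 (k :: J)) EkJ => ->.
  rewrite big_cons {1}/B2 eqxx; congr (_ * _)%E.
  by rewrite -(iS J B2 _ mB2)// -/(cyl S B2 J) EB2.
pose mpE : {mfun Omega >-> (Y * X)%type} :=
  HB.pack (fun w => (Z k w, S k w)) (isMeasurableFun.Build _ _ _ _ _ mp).
have PE0 : 0 <= fine (P E) by exact: fine_ge0.
(* [m1] is the law of [(Z k, S k)] on the event [E], [m2] the full law scaled by [P E]. Their
   agreement on rectangles extends to the preimage of [A] under [psi k]. *)
pose m1 : set (Y * X) -> \bar R := pushforward (mrestr P mE) mpE.
pose m2 := mscale (NngNum PE0) (distribution P mpE).
have m1E C : m1 C = P (mpE @^-1` C `&` E) by [].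
have m2E C : m2 C = (P (mpE @^-1` C) * P E)%E.
  by rewrite /m2 /mscale/= fineK ?fin_num_measure// muleC.
have : m1 (psi k @^-1` A) = m2 (psi k @^-1` A).
  apply: rectangle_measure_unique.
  - rewrite [ltLHS](m1E setT).
    apply: (@le_lt_trans _ _ (1%E : \bar R)); last by rewrite ltry.
    by rewrite preimage_setT setTI probability_le1.
  - by move=> A' B' mA' mB'; rewrite [RHS]m2E; exact: rect.
  - by rewrite -[X in measurable X]setTI; exact: mpsi.
by rewrite m1E m2E ZSE.
Qed.

End independence.

Section independent_expectation.
Context d dX dY (Omega : measurableType d) (X : measurableType dX)
  (Y : measurableType dY) (R : realType) (P : probability Omega R).

(** By independence the law of [(Z, S)] is a product, so Fubini lets the inner integral be taken
    with [Z] frozen at [z], where [S] may be replaced by the equally distributed [S0]. This takes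
    the place of conditioning on the past. *)
Lemma indep_Rintegral_le (Z : Omega -> Y) (S S0 : Omega -> X)
    (phi : Y * X -> R) (psi : Y -> R) :
  measurable_fun setT Z -> measurable_fun setT S -> measurable_fun setT S0 ->
  indep_rv P Z S ->
  (forall B, measurable B -> P (S @^-1` B) = P (S0 @^-1` B)) ->
  measurable_fun setT phi -> measurable_fun setT psi ->
  P.-integrable setT (EFin \o (fun w => phi (Z w, S w))) ->
  P.-integrable setT (EFin \o (fun w => psi (Z w))) ->
  (forall z, P.-integrable setT (EFin \o (fun w => phi (z, S0 w)))) ->
  (forall z, \int[P]_w phi (z, S0 w) <= psi z) ->
  \int[P]_w phi (Z w, S w) <= \int[P]_w psi (Z w).
Proof.
move=> mZ mS mS0 iZS eqS mphi mpsi iphi ipsi iphiz le_phi_psi.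
have mp : measurable_fun setT (fun w => (Z w, S w)).
  exact: measurable_fun_pair.
pose Zm : {RV P >-> Y} := HB.pack Z (isMeasurableFun.Build _ _ _ _ _ mZ).
pose Sm : {RV P >-> X} := HB.pack S (isMeasurableFun.Build _ _ _ _ _ mS).
pose S0m : {RV P >-> X} := HB.pack S0 (isMeasurableFun.Build _ _ _ _ _ mS0).
pose pm : {RV P >-> (Y * X)%type} :=
  HB.pack (fun w => (Z w, S w)) (isMeasurableFun.Build _ _ _ _ _ mp).
have mphiE : measurable_fun setT (fun x => (phi x)%:E).
  exact/measurable_EFinP.
have mpsiE : measurable_fun setT (fun x => (psi x)%:E).
  exact/measurable_EFinP.
have lawE C : measurable C ->
    (distribution P Zm \x distribution P Sm)%E C = distribution P pm C.
  by apply: product_measure_unique => A B mA mB; exact: iZS.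
have iprod : (distribution P Zm \x distribution P Sm)%E.-integrable setT
    (fun x => (phi x)%:E).
  have /integrableP[_ ip] : (distribution P pm).-integrable setT
      (fun x => (phi x)%:E).
    by apply: integrable_pushforward => //; exact: measurable_funP.
  apply/integrableP; split=> //.
  rewrite (eq_measure_integral (distribution P pm))//= => A mA _.
  exact: lawE.
have inner z : (\int[distribution P Sm]_s (phi (z, s))%:E =
    (\int[P]_w phi (z, S0 w))%:E)%E.
  rewrite (eq_measure_integral (distribution P S0m)); last first.
    by move=> A mA _; exact: eqS.
  have mphiz : measurable_fun setT (fun s => (phi (z, s))%:E).
    by apply/measurable_EFinP; exact: measurable_fun_pair2.
  rewrite (integral_distribution (X := S0m) mphiz (iphiz z)).
  by rewrite /Rintegral fineK//; exact: integrable_fin_num (iphiz z).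
rewrite -lee_fin /Rintegral !fineK; try exact: integrable_fin_num.
have -> : (\int[P]_w (phi (Z w, S w))%:E =
    \int[distribution P pm]_x (phi x)%:E)%E.
  by rewrite integral_distribution.
have -> : (\int[distribution P pm]_x (phi x)%:E =
    \int[distribution P Zm \x distribution P Sm]_x (phi x)%:E)%E.
  by apply: eq_measure_integral => A mA _; exact/esym/lawE.
rewrite -(integral12_prod_meas1 iprod).
have -> : (\int[P]_w (psi (Z w))%:E =
    \int[distribution P Zm]_x (psi x)%:E)%E.
  by rewrite integral_distribution.
apply: le_integral => //.
- exact: integrable_fubini_F.
- by apply: integrable_pushforward => //; exact: measurable_funP.
- by move=> z _; rewrite /fubini_F/= inner lee_fin.
Qed.

End independent_expectation.

(** * Mean-square bounds and almost sure sublinearity *)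

Section square_integrable.
Context d (Omega : measurableType d) (R : realType) (P : probability Omega R).
Implicit Types X Y : Omega -> R.

(** Measurability of [X] is a separate requirement because it does not follow from that of its
    square. *)
Definition sq_integrable X := measurable_fun setT X /\
  P.-integrable setT (EFin \o (fun w => X w ^+ 2)).

Lemma sq_integrableP X c : measurable_fun setT X ->
  (\int[P]_w (X w ^+ 2)%:E <= c%:E)%E -> sq_integrable X.
Proof.
move=> mX Xc; split=> //; apply/integrableP; split.
  by apply/measurable_EFinP; exact: measurable_funX.
under eq_integral do rewrite gee0_abs ?lee_fin ?sqr_ge0//.
by rewrite (le_lt_trans Xc)// ltry.
Qed.

Lemma le_integrable_real X Y : measurable_fun setT X ->
  (forall w, `|X w| <= Y w) -> P.-integrable setT (EFin \o Y) ->
  P.-integrable setT (EFin \o X).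
Proof.
move=> mX XY iY; apply: le_integrable iY => //; first exact/measurable_EFinP.
by move=> w _ /=; rewrite lee_fin (le_trans (XY w))// ler_norm.
Qed.

Lemma integrableD_real X Y : P.-integrable setT (EFin \o X) ->
  P.-integrable setT (EFin \o Y) ->
  P.-integrable setT (EFin \o (fun w => X w + Y w)).
Proof. by move=> iX iY; exact: (integrableD measurableT iX iY). Qed.

Lemma integrableZ_real c X : P.-integrable setT (EFin \o X) ->
  P.-integrable setT (EFin \o (fun w => c * X w)).
Proof. by move=> iX; exact: (integrableZl measurableT c iX). Qed.

Lemma integrable_cst_real c : P.-integrable setT (EFin \o (fun=> c : R)).
Proof. exact: (finite_measure_integrable_cst P c). Qed.

Lemma Rintegral_cst_probability c : \int[P]_w c = c.
Proof. by rewrite Rintegral_cst//= probability_setT mulr1. Qed.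

Lemma sq_integrable_le X Y : measurable_fun setT X ->
  (forall w, `|X w| <= `|Y w|) -> sq_integrable Y -> sq_integrable X.
Proof.
move=> mX XY [mY iY]; split=> //; apply: le_integrable_real iY => [|w].
  exact: measurable_funX.
by rewrite normrX -(real_normK (num_real (Y w))) lerXn2r ?nnegrE.
Qed.

Lemma sq_integrable_cst c : sq_integrable (fun=> c).
Proof. by split; [exact: measurable_cst|exact: integrable_cst_real]. Qed.

Lemma sq_integrable_bounded X c : measurable_fun setT X ->
  (forall w, `|X w| <= c) -> sq_integrable X.
Proof.
move=> mX Xc; apply: sq_integrable_le (sq_integrable_cst c) => // w.
by rewrite (le_trans (Xc w))// ler_norm.
Qed.

Lemma sq_integrableD X Y : sq_integrable X -> sq_integrable Y ->
  sq_integrable (fun w => X w + Y w).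
Proof.
move=> [mX iX] [mY iY]; split; first exact: measurable_funD.
apply: le_integrable_real (integrableD_real (integrableZ_real 2 iX)
  (integrableZ_real 2 iY)) => [|w].
  by apply: measurable_funX; exact: measurable_funD.
rewrite ger0_norm ?sqr_ge0//.
have := sqr_ge0 (X w - Y w); nra.
Qed.

Lemma sq_integrableZ c X : sq_integrable X ->
  sq_integrable (fun w => c * X w).
Proof.
move=> [mX iX]; split; first exact: measurable_funM.
apply: le_integrable_real (integrableZ_real (c ^+ 2) iX) => [|w].
  by apply: measurable_funX; exact: measurable_funM.
by rewrite ger0_norm ?sqr_ge0// exprMn.
Qed.

Lemma sq_integrableM X Y : sq_integrable X -> sq_integrable Y ->
  P.-integrable setT (EFin \o (fun w => X w * Y w)).
Proof.
move=> [mX iX] [mY iY].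
apply: le_integrable_real (integrableD_real iX iY) => [|w].
  exact: measurable_funM.
rewrite ler_norml; apply/andP; split.
  have := sqr_ge0 (X w + Y w); have := sqr_ge0 (X w); nra.
have := sqr_ge0 (X w - Y w); have := sqr_ge0 (X w); nra.
Qed.

Lemma sq_integrable_integrable X : sq_integrable X ->
  P.-integrable setT (EFin \o X).
Proof.
move=> /sq_integrableM/(_ (sq_integrable_cst 1)).
by apply: eq_integrable => // w _ /=; rewrite mulr1.
Qed.

End square_integrable.

(** * Elementary inequalities for sums and squares *)

(** Cauchy-Schwarz against the constant sequence [1]. In the induction step, after multiplying by
    [n], the claim reduces to [(s - n b)^2 >= 0]; this is why [n = 0] is treated apart. *)
Lemma sqr_sum_le (R : realFieldType) (b : nat -> R) (m n : nat) :
  (\sum_(m <= i < m + n) b i) ^+ 2 <= n%:R * \sum_(m <= i < m + n) b i ^+ 2.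
Proof.
elim: n => [|n IH]; first by rewrite addn0 !big_geq// expr2 mul0r.
rewrite addnS !big_nat_recr ?leq_addr//=.
move: IH; set s := \sum_(_ <= i < _) b i; set q := \sum_(_ <= i < _) _ ^+ 2.
move=> IH; rewrite -[X in X%:R]addn1 natrD.
have [n0|n0] := posnP n.
  have -> : s = 0 by rewrite /s n0 addn0 big_geq.
  have -> : q = 0 by rewrite /q n0 addn0 big_geq.
  by rewrite n0 !add0r mul1r.
have n0' : 0 < n%:R :> R by rewrite ltr0n.
suff : 0 <= n%:R * (q + n%:R * b (m + n)%N ^+ 2 - 2 * s * b (m + n)%N).
  by rewrite pmulr_rge0//; nra.
by have := sqr_ge0 (s - n%:R * b (m + n)%N); nra.
Qed.

(** The induction runs on the sharper bound [2 - 1 / (N + 1)] for [N + 1] terms, which leaves room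
    for the next term. *)
Lemma sum_inv_sqr_le (R : realFieldType) (N : nat) :
  \sum_(0 <= n < N) (n.+1%:R ^+ 2)^-1 <= 2 :> R.
Proof.
suff : \sum_(0 <= n < N.+1) (n.+1%:R ^+ 2)^-1 <= 2 - N.+1%:R^-1 :> R.
  have : 0 <= N.+1%:R^-1 :> R by rewrite invr_ge0.
  have : 0 <= (N.+1%:R ^+ 2)^-1 :> R by rewrite invr_ge0 sqr_ge0.
  rewrite big_nat_recr//=; move: (_ ^-1) (_ ^-1) (\sum_(_ <= _ < _) _).
  by move=> a b c; lra.
elim: N => [|N IH]; first by rewrite big_nat1 expr1n invr1; lra.
rewrite big_nat_recr//=; apply: (le_trans (lerD IH (lexx _))).
have n0 : 0 < N.+1%:R :> R by rewrite ltr0n.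
rewrite -[in X in _ <= X]addn1 -[in X in X <= _]addn1 natrD.
rewrite -[N.+2]addn1 natrD.
set x := N.+1%:R : R; rewrite -/x in n0.
have -> : 2 - x^-1 + ((x + 1) ^+ 2)^-1 = 2 - (x + 1)^-1
    - (x * (x + 1) ^+ 2)^-1.
  by field; rewrite !gt_eqF//; lra.
by rewrite lerBlDr lerDl invr_ge0 mulr_ge0 ?sqr_ge0 ?ltW.
Qed.

Lemma between_squares (K : nat) : exists n : nat,
  (n ^ 2 <= K < n.+1 ^ 2)%N.
Proof.
elim: K => [|K [n /andP[nK Kn]]]; first by exists 0%N.
have [Kn'|Kn'] := ltnP K.+1 (n.+1 ^ 2); first by exists n; rewrite Kn' leqW.
exists n.+1; rewrite Kn'/= (leq_ltn_trans Kn)// ltn_sqr//.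
Qed.

(** * Almost sure sublinear growth from second moments *)

Section sublinear_growth.
Context d (Omega : measurableType d) (R : realType) (P : probability Omega R).

Lemma ge0_integralZl_real (c : R) (X : Omega -> R) : 0 <= c ->
  measurable_fun setT X -> (forall w, 0 <= X w) ->
  (\int[P]_w (c * X w)%:E = c%:E * \int[P]_w (X w)%:E)%E.
Proof.
move=> c0 /measurable_EFinP mX X0.
have := @ge0_integralZl_EFin _ _ _ P setT measurableT (EFin \o X) _ mX c c0.
by apply => w _; rewrite /= lee_fin.
Qed.

Lemma ge0_integralD_real (X Y : Omega -> R) :
  measurable_fun setT X -> measurable_fun setT Y ->
  (forall w, 0 <= X w) -> (forall w, 0 <= Y w) ->
  (\int[P]_w (X w + Y w)%:E = \int[P]_w (X w)%:E + \int[P]_w (Y w)%:E)%E.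
Proof.
move=> /measurable_EFinP mX /measurable_EFinP mY X0 Y0.
by rewrite -ge0_integralD// => w _; rewrite lee_fin.
Qed.

(** By monotone convergence the sum of all [X n] has a finite mean, so it is finite almost surely,
    and the terms of a convergent series tend to [0]. *)
Lemma ae_cvg0_summable (X : nat -> Omega -> R) (a : nat -> R) (C : R) :
  (forall n, measurable_fun setT (X n)) -> (forall n w, 0 <= X n w) ->
  (forall n, (\int[P]_w (X n w)%:E <= (a n)%:E)%E) ->
  (forall N, \sum_(0 <= n < N) a n <= C) ->
  {ae P, forall w, X n w @[n --> \oo] --> 0}.
Proof.
move=> mX X0 Xa aC.
pose Y w := (\sum_(n <oo) (X n w)%:E)%E.
have mXE n : measurable_fun setT (fun w => (X n w)%:E).
  exact/measurable_EFinP.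
have Y0 w : (0 <= Y w)%E by apply: nneseries_ge0 => n _ _; rewrite lee_fin.
have iY : P.-integrable setT Y.
  apply/integrableP; split.
    by apply: ge0_emeasurable_sum => // n w _ _; rewrite lee_fin.
  under eq_integral do rewrite gee0_abs//.
  rewrite /Y integral_nneseries//; last by move=> n w _; rewrite lee_fin.
  apply: (@le_lt_trans _ _ C%:E); last by rewrite ltry.
  apply: lime_le.
    apply: is_cvg_nneseries => n _ _; apply: integral_ge0 => w _.
    by rewrite lee_fin.
  apply: nearW => N; apply: (@le_trans _ _ (\sum_(0 <= n < N) a n)%:E).
    by rewrite -sumEFin; apply: lee_sum => n _; exact: Xa.
  by rewrite lee_fin.
have := integrable_ae measurableT iY.
apply: filterS => w /(_ I) Yfin.
apply: cvg_series_cvg_0.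
apply: nondecreasing_is_cvgn.
  by apply/nondecreasing_seqP => n; rewrite /series/= big_nat_recr//= lerDl.
exists (fine (Y w)) => _ [N _ <-].
rewrite -lee_fin fineK// /series/= -sumEFin.
by apply: nneseries_lim_ge => n _; rewrite lee_fin.
Qed.

(** The mean of [(A K / K)^2] is only [O(1 / K)], which is not summable over all [K] but is along
    squares. The variation up to the next square is bundled into the same summable sequence [X]. *)
Lemma ae_sublinear (A B : nat -> Omega -> R) (C : R) :
  (forall k, measurable_fun setT (A k)) ->
  (forall k, measurable_fun setT (B k)) ->
  (forall k w, 0 <= A k w) ->
  (forall k w, `|A k.+1 w - A k w| <= `|B k w|) ->
  (forall k, (\int[P]_w (A k w ^+ 2)%:E <= (C * k%:R)%:E)%E) ->
  (forall k, (\int[P]_w (B k w ^+ 2)%:E <= C%:E)%E) ->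
  {ae P, forall w, A K w / K%:R @[K --> \oo] --> 0}.
Proof.
move=> mA mB A0 AB AC BC.
(* There are [2 n + 3] steps from [n.+1 ^ 2] to [n.+2 ^ 2]. By Cauchy-Schwarz the square of the sum
   of their [|B i|] is at most [n.*2.+3%:R * gap n], so [X n] controls [A K / K] on the whole
   stretch. *)
pose gap n w := \sum_(n.+1 ^ 2 <= i < n.+1 ^ 2 + n.*2.+3) B i w ^+ 2.
pose X n w := (n.+1%:R ^+ 4)^-1 *
  (A (n.+1 ^ 2)%N w ^+ 2 + n.*2.+3%:R * gap n w).
have C0 : 0 <= C.
  rewrite -lee_fin; apply: le_trans (BC 0%N).
  by apply: integral_ge0 => w _; rewrite lee_fin sqr_ge0.
have mB2 k : measurable_fun setT (fun w => B k w ^+ 2).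
  exact: measurable_funX.
have mgap n : measurable_fun setT (gap n) by exact: measurable_sum.
have gap0 n w : 0 <= gap n w by apply: sumr_ge0 => i _; exact: sqr_ge0.
have mX n : measurable_fun setT (X n).
  apply: measurable_funM => //; apply: measurable_funD.
    exact: measurable_funX.
  exact: measurable_funM.
have X0 n w : 0 <= X n w.
  rewrite mulr_ge0 ?invr_ge0 ?exprn_ge0//.
  by rewrite addr_ge0 ?sqr_ge0// mulr_ge0.
(* With [x = n.+1], the two terms contribute at most [C x^2] and [(2 x + 1)^2 C <= 9 C x^2], both
   divided by [x^4]: hence the [10]. *)
have XC n : (\int[P]_w (X n w)%:E <= (10 * C * (n.+1%:R ^+ 2)^-1)%:E)%E.
  rewrite /X ge0_integralZl_real; last 3 first.
  - by rewrite invr_ge0 exprn_ge0.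
  - apply: measurable_funD; last exact: measurable_funM.
    exact: measurable_funX.
  - by move=> w; rewrite addr_ge0 ?sqr_ge0// mulr_ge0.
  rewrite ge0_integralD_real; last 4 first.
  - exact: measurable_funX.
  - exact: measurable_funM.
  - by move=> w; rewrite sqr_ge0.
  - by move=> w; rewrite mulr_ge0.
  have gapC : (\int[P]_w (n.*2.+3%:R * gap n w)%:E <=
      (n.*2.+3%:R * (n.*2.+3%:R * C))%:E)%E.
    rewrite ge0_integralZl_real// EFinM lee_pmul2l// /gap.
    under eq_integral do rewrite -sumEFin.
    have mB2E i : measurable_fun setT (fun w => (B i w ^+ 2)%:E).
      exact/measurable_EFinP.
    have B2E i w : setT w -> (0 <= (B i w ^+ 2)%:E)%E.
      by rewrite lee_fin sqr_ge0.
    rewrite (ge0_integral_sum P measurableT mB2E B2E).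
    apply: (@le_trans _ _
      (\sum_(n.+1 ^ 2 <= i < n.+1 ^ 2 + n.*2.+3) C%:E)%E).
      by apply: lee_sum => i _; exact: BC.
    by rewrite sumEFin sumr_const_nat addKn mulr_natl.
  apply: (@le_trans _ _ ((n.+1%:R ^+ 4)^-1%:E *
      ((C * (n.+1 ^ 2)%:R)%:E + (n.*2.+3%:R * (n.*2.+3%:R * C))%:E))%E).
    rewrite lee_pmul2l// ?lte_fin ?invr_gt0 ?exprn_gt0//.
    by rewrite leeD//; exact: AC.
  rewrite -EFinD -EFinM lee_fin ler_pdivrMl ?exprn_gt0// natrX.
  have -> : n.*2.+3%:R = 2 * n.+1%:R + 1 :> R.
    have -> : n.*2.+3 = (2 * n.+1 + 1)%N by lia.
    by rewrite natrD natrM.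
  set x := n.+1%:R : R.
  have x1 : 1 <= x by rewrite ler1n.
  have -> : x ^+ 4 * (10 * C * (x ^+ 2)^-1) = x ^+ 2 * 10 * C.
    by field; rewrite gt_eqF// (lt_le_trans ltr01).
  nra.
have sum10 N : \sum_(0 <= n < N) 10 * C * (n.+1%:R ^+ 2)^-1 <= 20 * C.
  have := sum_inv_sqr_le R N; rewrite -mulr_sumr; move: (\sum_(_ <= _ < _) _).
  by move=> s s2; nra.
have := ae_cvg0_summable mX X0 XC sum10.
apply: filterS => w Xw.
apply/cvgr0Pnorm_lt => e e0.
have : \forall n \near \oo, `|X n w| < e ^+ 2 / 2.
  move/cvgr0Pnorm_lt : Xw; apply.
  by rewrite divr_gt0 ?exprn_gt0.
move=> [N _ XN]; exists (N.+1 ^ 2)%N => // K /= NK.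
have [n /andP[nK Kn]] := between_squares K.
have Nn : (N < n)%N.
  rewrite -ltnS -ltn_sqr; exact: leq_ltn_trans Kn.
(* As [n] exceeds [N] it is a successor; from here on [n.+1] is the integer square root of [K]. *)
case: n => // n in nK Kn Nn *.
have := XN n Nn; rewrite /= ger0_norm// => XnE.
have K0 : 0 < K%:R :> R by rewrite ltr0n (leq_trans _ nK)// expn_gt0.
rewrite ger0_norm; last by rewrite divr_ge0.
rewrite -(@ltr_pXn2r _ 2)// ?nnegrE ?divr_ge0//; last exact: ltW.
(* The factor [2] comes from squaring a sum of two terms, the value at the preceding square and the
   increments since; the threshold [e ^+ 2 / 2] on [X n] absorbs it. *)
suff : (A K w / K%:R) ^+ 2 <= 2 * X n w by lra.
have AK : A K w <= A (n.+1 ^ 2)%N w +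
    \sum_(n.+1 ^ 2 <= i < n.+1 ^ 2 + n.*2.+3) `|B i w|.
  have step j : (j <= n.*2.+3)%N -> A (n.+1 ^ 2 + j)%N w <= A (n.+1 ^ 2)%N w +
     \sum_(n.+1 ^ 2 <= i < n.+1 ^ 2 + j) `|B i w|.
    elim: j => [|j IH] jn; first by rewrite addn0 big_geq// addr0.
    rewrite addnS big_nat_recr ?leq_addr//= addrA.
    have := AB (n.+1 ^ 2 + j)%N w; rewrite ler_norml => /andP[_ +].
    by have := IH (ltnW jn); lra.
  have -> : K = (n.+1 ^ 2 + (K - n.+1 ^ 2))%N by rewrite subnKC.
  have Kj : (K - n.+1 ^ 2 <= n.*2.+3)%N.
    by move: Kn; lia.
  apply: (le_trans (step _ Kj)); rewrite lerD2l.
  rewrite (@big_cat_nat _ _ _ (n.+1 ^ 2 + (K - n.+1 ^ 2))%N _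
    (n.+1 ^ 2 + n.*2.+3)%N) ?leq_addr ?leq_add2l//= lerDl.
  by apply: sumr_ge0.
have := sqr_sum_le (fun i => `|B i w|) (n.+1 ^ 2) n.*2.+3.
under [X in _ <= _ * X]eq_bigr do rewrite real_normK ?num_real//.
rewrite -/(gap n w).
move: AK; set s := \sum_(_ <= i < _) `|_|; move=> AK sgap.
rewrite /X expr_div_n ler_pdivrMr ?exprn_gt0//.
have s0 : 0 <= s by exact: sumr_ge0.
have nK4 : n.+1%:R ^+ 4 <= K%:R ^+ 2 :> R.
  rewrite -[4%N]/(2 * 2)%N exprM lerXn2r ?nnegrE ?exprn_ge0//.
  by rewrite -natrX ler_nat.
have n40 : 0 < n.+1%:R ^+ 4 :> R by rewrite exprn_gt0.
set a := A (n.+1 ^ 2)%N w in AK *.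
have a0 : 0 <= a by exact: A0.
apply: (@le_trans _ _ (2 * (a ^+ 2 + n.*2.+3%:R * gap n w))).
  have := A0 K w; have := sqr_ge0 (a - s); nra.
rewrite -mulrA ler_pM2l// mulrAC ler_peMl//.
  by rewrite addr_ge0 ?sqr_ge0// mulr_ge0.
by rewrite ler_pdivlMl// mulr1.
Qed.

End sublinear_growth.

(** * One-shot expectations and the optimal ratio *)

(** An open set is the union of the rational boxes it contains, and these are countably many. The
    purpose is to make the compact sets [D s] measurable for the product sigma-algebra. *)
Lemma open_measurable_prod (R : realType) (U : set (R * R)) :
  open U -> measurable U.
Proof.
move=> oU.
pose box (q : (rat * rat) * (rat * rat)) : set (R * R) :=
  `]ratr q.1.1, ratr q.1.2[ `*` `]ratr q.2.1, ratr q.2.2[.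
have -> : U = \bigcup_(q in [set q | box q `<=` U]) box q.
  apply/seteqP; split=> [z Uz|z [q qU]]; last exact: qU.
  have /nbhs_ballP[e /= e0 zeU] : nbhs z U by exact: open_nbhs_nbhs.
  have ratP (x : R) : exists2 q : rat * rat, ratr q.1 < x < ratr q.2 &
      forall y, ratr q.1 < y < ratr q.2 -> ball x e y.
    have [|a] := @rat_in_itvoo R (x - e) x; first by lra.
    rewrite in_itv/= => /andP[xa ax].
    have [|b] := @rat_in_itvoo R x (x + e); first by lra.
    rewrite in_itv/= => /andP[xb bx].
    exists (a, b); first by rewrite /= ax xb.
    move=> y /= /andP[ay yb].
    by rewrite -ball_normE/= ltr_distlC; lra.
  have [q1 zq1 q1e] := ratP z.1.
  have [q2 zq2 q2e] := ratP z.2.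
  exists (q1, q2); last by split; rewrite /= in_itv.
  move=> y [/=]; rewrite !in_itv/= => y1 y2.
  by apply: zeU; split; [exact: q1e|exact: q2e].
rewrite bigcup_mkcond; apply: countable_bigcupT_measurable => // q.
by case: ifPn => // _; exact: measurableX.
Qed.

Lemma compact_measurable_prod (R : realType) (K : set (R * R)) :
  compact K -> measurable K.
Proof.
have hT : hausdorff_space (R * R)%type.
  exact: (@norm_hausdorff R (R^o * R^o)%type).
move=> /(compact_closed hT)/closed_openC/open_measurable_prod/measurableC.
by rewrite setCK.
Qed.

(** * Integrals against a probability concentrated on a set *)

Section concentrated_measure.
Context d (T : measurableType d) (R : realType).
Variables (mu : {measure set T -> \bar R}) (A : set T).
Hypotheses (mA : measurable A) (muT : mu setT = 1%E) (muA : mu A = 1%E).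

Let muAC : mu (~` A) = 0%E.
Proof.
have -> : mu (~` A) = (mu setT - mu A)%E.
  rewrite -setTD measureD//; first by rewrite setTI.
  by rewrite [ltLHS]muT ltry.
by rewrite muT muA subee.
Qed.

Let TA : setT `\` ~` A = A.
Proof. by rewrite setTD setCK. Qed.

Lemma concentrated_integrable (h : T -> R) (c : R) : measurable_fun setT h ->
  (forall z, A z -> `|h z| <= c) -> mu.-integrable setT (EFin \o h).
Proof.
move=> mh hc.
have mhE : measurable_fun setT (EFin \o h) by exact/measurable_EFinP.
apply/(negligible_integrable (measurableC mA) measurableT mhE muAC).
rewrite TA; apply: measurable_bounded_integrable => //.
- by rewrite muA ltry.
- exact: measurable_funTS.
- exists c; split; [exact: num_real|] => M cM z Az /=.
  by rewrite (le_trans (hc z Az))// ltW.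
Qed.

Lemma le_concentrated_Rintegral (h1 h2 : T -> R) :
  mu.-integrable setT (EFin \o h1) -> mu.-integrable setT (EFin \o h2) ->
  (forall z, A z -> h1 z <= h2 z) ->
  \int[mu]_z h1 z <= \int[mu]_z h2 z.
Proof.
move=> i1 i2 h12; rewrite /Rintegral.
rewrite (negligible_integral (measurableC mA) measurableT i1 muAC).
rewrite (negligible_integral (measurableC mA) measurableT i2 muAC) TA.
by apply: le_Rintegral => //; apply: integrableS (measurableT) mA _ _.
Qed.

Lemma concentrated_Rintegral_cst (c : R) : \int[mu]_z c = c.
Proof. by rewrite Rintegral_cst//= muT mulr1. Qed.

End concentrated_measure.

(** Measurability of kernel integrals is applied to nonnegative integrands, hence the split of [h]
    into positive and negative parts. *)
Lemma measurable_Rintegral_kernel d d' (X : measurableType d)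
    (Y : measurableType d') (R : realType) (k : R.-pker X ~> Y) (h : Y -> R) :
  measurable_fun setT h -> measurable_fun setT (fun x => \int[k x]_y h y).
Proof.
move=> mh; apply: measurableT_comp => //=.
under eq_fun do rewrite integralE.
have mhE : measurable_fun setT (fun y => (h y)%:E) by exact/measurable_EFinP.
apply: emeasurable_funB; apply: measurable_fun_integral_kernel => //.
- by move=> U mU; exact: measurable_kernel.
- exact: measurable_funepos.
- by move=> U mU; exact: measurable_kernel.
- exact: measurable_funeneg.
Qed.

(** Turns a supremum of ratios into linear statements: [s] is the value at which the supremum of
    [p.2 - s * p.1] over [A] is zero. The bounds on [A] are closed conditions, so they survive on
    the closure and keep the ratios under control. *)
Lemma sup_ratio_closure (R : realType) (A : set (R * R)) (l K : R) :
  0 < l -> A !=set0 ->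
  (forall p, A p -> l <= p.1 <= K /\ p.2 <= K) ->
  let s := sup [set p.2 / p.1 | p in closure A] in
  (forall p, A p -> p.2 - s * p.1 <= 0) /\
  (forall c, (forall p, A p -> p.2 - s * p.1 <= - c) -> c <= 0).
Proof.
move=> l0 [p0 Ap0] AlK s.
have fstc : continuous (fun q : R * R => q.1) by move=> q; exact: cvg_fst.
have sndc : continuous (fun q : R * R => q.2) by move=> q; exact: cvg_snd.
have closureP (f : R * R -> R) (c : R) : continuous f ->
    (forall p, A p -> f p <= c) -> forall p, closure A p -> f p <= c.
  move=> cf fc p; have : closed (f @^-1` [set x | x <= c]).
    by apply: preimage_closed; [move=> ? _; exact: cf|exact: closed_le].
  by move=> /closure_id fE /(closureS fc); rewrite -fE.
have cl1 p : closure A p -> l <= p.1.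
  move=> clp; rewrite -lerN2.
  apply: (closureP (fun q => - q.1)) clp => [q|q /AlK[/andP[lq _] _]].
    by apply: cvgN; exact: fstc.
  by rewrite lerN2.
have cl1K p : closure A p -> p.1 <= K.
  by apply: (closureP fst) => // q /AlK[/andP[_ qK] _].
have cl2 p : closure A p -> p.2 <= K.
  by apply: (closureP snd) => // q /AlK[].
have K0 : 0 < K.
  have [/andP[lp pK] _] := AlK _ Ap0.
  by rewrite (lt_le_trans l0)// (le_trans lp).
have hs : has_sup [set p.2 / p.1 | p in closure A].
  split; first by exists (p0.2 / p0.1), p0 => //; exact: subset_closure.
  (* Numerators are at most [K > 0] and denominators at least [l]. Boundedness matters, since [sup]
     of an unbounded set is a default value. *)
  exists (K / l) => _ [p clp <-].
  have lp := cl1 _ clp; have pK := cl2 _ clp.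
  rewrite ler_pdivrMr ?(lt_le_trans l0)// mulrAC ler_pdivlMr//.
  by rewrite (le_trans (ler_wpM2r (ltW l0) pK))// ler_wpM2l// ltW.
split=> [p Ap|c Ac].
  have clp : closure A p by exact: subset_closure.
  have p1 : 0 < p.1 by rewrite (lt_le_trans l0)// cl1.
  rewrite subr_le0 -ler_pdivrMr//.
  by apply: (sup_upper_bound hs); exists p.
rewrite leNgt; apply/negP => c0.
(* If [c > 0], every ratio in the closure is at most [s - c / p.1 <= s - c / K], so [s] would not be
   the least upper bound. *)
suff : s <= s - c / K by rewrite lerBrDr gerDl leNgt divr_gt0.
apply: ge_sup; first by case: hs.
move=> _ [p clp <-].
have p1 : 0 < p.1 by rewrite (lt_le_trans l0)// cl1.
rewrite ler_pdivrMr// mulrBl.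
have : p.2 - s * p.1 <= - c.
  apply: (closureP (fun q => q.2 - s * q.1)) clp => // q.
  by apply: cvgB; [exact: sndc|apply: cvgM; [exact: cvg_cst|exact: fstc]].
suff : c / K * p.1 <= c by lra.
by rewrite mulrAC ler_pdivrMr// ler_pM2l//; exact: cl1K.
Qed.

(** * Expectations achievable on one frame *)

Section one_shot.
Context d dX (Omega : measurableType d) (X : measurableType dX) (R : realType).
Variables (P : probability Omega R) (S0 : Omega -> X) (D : X -> set (R * R)).
Variables (L M : X -> R).
Hypotheses (mS0 : measurable_fun setT S0) (Dset : decision_sets D)
  (env : moment_envelope P S0 D L M).

Let mLM : measurable_fun setT (L \o S0) /\ measurable_fun setT (M \o S0).
Proof. by have [] := env. Qed.

Let LM0 s : 0 <= L s /\ 0 <= M s.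
Proof. by have [] := env. Qed.

(** Since [|x| <= 1 + x^2], the single integrable function [1 + M] dominates both coordinates of
    every decision. *)
Lemma envelope_fst s p : D s p -> L s <= p.1 <= 1 + M s.
Proof.
have [_ + _ _ _] := env => /[apply] -[-> pM] /=.
have := sqr_ge0 (p.1 - 1); have := sqr_ge0 p.2; have := sqr_ge0 p.1; nra.
Qed.

Lemma envelope_snd s p : D s p -> `|p.2| <= 1 + M s.
Proof.
have [_ + _ _ _] := env => /[apply] -[_ pM] /=.
have := sqr_ge0 (p.2 - 1); have := sqr_ge0 (p.2 + 1); have := sqr_ge0 p.1.
by move=> *; rewrite ler_norml; nra.
Qed.

Lemma integrable_envelopeM :
  P.-integrable setT (EFin \o (fun w => 1 + M (S0 w))).
Proof.
apply: integrableD_real; first exact: integrable_cst_real.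
have [_ _ _ _ EM] := env.
apply/integrableP; split; first by apply/measurable_EFinP; exact: mLM.2.
under eq_integral do rewrite gee0_abs ?lee_fin ?(LM0 _).2//.
by rewrite unlock in EM.
Qed.

Hypothesis D0 : forall s, D s !=set0.

(** [L] and [M] are compared through a point of [D s], which is where nonemptiness enters. *)
Lemma integrable_envelopeL :
  P.-integrable setT (EFin \o (fun w => L (S0 w))).
Proof.
apply: le_integrable_real integrable_envelopeM => [|w]; first exact: mLM.1.
have [p /envelope_fst/andP[Lp pM]] := D0 (S0 w).
by rewrite ger0_norm ?(LM0 _).1// (le_trans Lp).
Qed.

Lemma envelopeL_gt0 : 0 < \int[P]_w L (S0 w).
Proof.
have [_ _ _ + _] := env; rewrite unlock /= /Rintegral => EL.
rewrite -lte_fin fineK//; exact: integrable_fin_num integrable_envelopeL.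
Qed.

(** Bounds valid on each [D s] are integrated first against the kernel, which is concentrated on
    [D s], and then over the state. In use, [v] bounds [r - theta t] on each [D s], so randomizing
    the decision cannot beat it. *)
Lemma one_shot_bounds (p : R * R) : one_shot_expectations P S0 D p ->
  \int[P]_w L (S0 w) <= p.1 <= \int[P]_w (1 + M (S0 w)) /\
  forall theta (v : X -> R), P.-integrable setT (EFin \o (fun w => v (S0 w))) ->
    (forall s q, D s q -> q.2 - theta * q.1 <= v s) ->
    p.2 - theta * p.1 <= \int[P]_w v (S0 w).
Proof.
move=> [k [kD p1E p2E]].
have mD s : measurable (D s).
  by apply: compact_measurable_prod; have [] := Dset s.
have kT s : k s setT = 1%E by exact: prob_kernel.
have D1 s z : D s z -> `|z.1| <= 1 + M s.
  move=> Dz; have /andP[Lz zM] := envelope_fst Dz.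
  by rewrite ger0_norm// (le_trans (LM0 s).1).
have i1 s : (k s).-integrable setT (EFin \o (fun z => z.1)).
  exact: (concentrated_integrable (mD s) (kT s) (kD s) measurable_fst (D1 s)).
have i2 s : (k s).-integrable setT (EFin \o (fun z => z.2)).
  exact: (concentrated_integrable (mD s) (kT s) (kD s) measurable_snd
    (@envelope_snd s)).
(* Conditional means of duration and reward given the state [s]. *)
pose a s := \int[k s]_z z.1; pose b s := \int[k s]_z z.2.
have ic s (c : R) : (k s).-integrable setT (EFin \o (fun=> c)).
  by apply: (concentrated_integrable (mD s) (kT s) (kD s) (c := `|c|)).
have aL s : L s <= a s <= 1 + M s.
  apply/andP; split.
    rewrite -[leLHS](concentrated_Rintegral_cst (kT s)).
    apply: (le_concentrated_Rintegral (mD s) (kT s) (kD s)) => // z.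
    by move=> /envelope_fst/andP[].
  rewrite -[leRHS](concentrated_Rintegral_cst (kT s)).
  apply: (le_concentrated_Rintegral (mD s) (kT s) (kD s)) => // z.
  by move=> /envelope_fst/andP[].
have bM s : `|b s| <= 1 + M s.
  rewrite ler_norml; apply/andP; split.
    rewrite -[leLHS](concentrated_Rintegral_cst (kT s)).
    apply: (le_concentrated_Rintegral (mD s) (kT s) (kD s)) => // z.
    by move=> /envelope_snd; rewrite ler_norml => /andP[].
  rewrite -[leRHS](concentrated_Rintegral_cst (kT s)).
  apply: (le_concentrated_Rintegral (mD s) (kT s) (kD s)) => // z.
  by move=> /envelope_snd; rewrite ler_norml => /andP[].
have ma : measurable_fun setT (fun w => a (S0 w)).
  by apply: measurableT_comp => //; exact: measurable_Rintegral_kernel.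
have mb : measurable_fun setT (fun w => b (S0 w)).
  by apply: measurableT_comp => //; exact: measurable_Rintegral_kernel.
have ia : P.-integrable setT (EFin \o (fun w => a (S0 w))).
  apply: le_integrable_real integrable_envelopeM => // w.
  have /andP[La aM] := aL (S0 w).
  by rewrite ger0_norm//; exact: le_trans (LM0 _).1 La.
have ib : P.-integrable setT (EFin \o (fun w => b (S0 w))).
  exact: le_integrable_real integrable_envelopeM.
have -> : p.1 = \int[P]_w a (S0 w).
  rewrite /Rintegral -[LHS]/(fine p.1%:E) p1E; congr fine.
  apply: eq_integral => w _.
  by rewrite fineK//; exact: integrable_fin_num (i1 _).
have -> : p.2 = \int[P]_w b (S0 w).
  rewrite /Rintegral -[LHS]/(fine p.2%:E) p2E; congr fine.
  apply: eq_integral => w _.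
  by rewrite fineK//; exact: integrable_fin_num (i2 _).
split.
  apply/andP; split; apply: le_Rintegral => //.
  - exact: integrable_envelopeL.
  - by move=> w _; have /andP[] := aL (S0 w).
  - exact: integrable_envelopeM.
  - by move=> w _; have /andP[] := aL (S0 w).
move=> theta v iv vD.
have ia' : P.-integrable setT (EFin \o (fun w => theta * a (S0 w))).
  exact: integrableZ_real.
rewrite -RintegralZl// -RintegralB//.
apply: le_Rintegral => //; first exact: (integrableB measurableT ib ia').
move=> w _; set s := S0 w.
rewrite -[leRHS](concentrated_Rintegral_cst (kT s)).
have ia2 : (k s).-integrable setT (EFin \o (fun z => theta * z.1)).
  exact: (integrableZl measurableT theta (i1 s)).
rewrite /a /b -RintegralZl// -RintegralB//.
apply: (le_concentrated_Rintegral (mD s) (kT s) (kD s)) => //.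
  exact: (integrableB measurableT (i2 s) ia2).
by move=> z; exact: vD.
Qed.

(** A deterministic rule is the kernel of Dirac masses at its decisions. *)
Lemma one_shot_rule (g : X -> R * R) : measurable_fun setT g ->
  (forall s, D s (g s)) ->
  one_shot_expectations P S0 D
    (\int[P]_w (g (S0 w)).1, \int[P]_w (g (S0 w)).2).
Proof.
move=> mg Dg; exists (kdirac mg); split=> /=.
- by move=> s; rewrite /kdirac/= diracE mem_set.
- have ig : P.-integrable setT (EFin \o (fun w => (g (S0 w)).1)).
    apply: le_integrable_real integrable_envelopeM => [|w].
      apply: measurableT_comp; first exact: measurable_fst.
      exact: measurableT_comp.
    have /andP[Lg gM] := envelope_fst (Dg (S0 w)).
    by rewrite ger0_norm//; exact: le_trans (LM0 _).1 Lg.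
  rewrite /Rintegral fineK; last exact: integrable_fin_num ig.
  apply: eq_integral => w _; rewrite integral_dirac//= ?diracT ?mul1e//.
  exact/measurable_EFinP.
- have ig : P.-integrable setT (EFin \o (fun w => (g (S0 w)).2)).
    apply: le_integrable_real integrable_envelopeM => [|w].
      apply: measurableT_comp; first exact: measurable_snd.
      exact: measurableT_comp.
    exact: envelope_snd.
  rewrite /Rintegral fineK; last exact: integrable_fin_num ig.
  apply: eq_integral => w _; rewrite integral_dirac//= ?diracT ?mul1e//.
  exact/measurable_EFinP.
Qed.

(** The two halves, applied to a rule maximizing [r - s t], force the mean of that maximum to be
    zero. In the second half the rule [g] serves to make the set of one-shot expectations
    nonempty. *)
Lemma optimal_ratioP :
  let s := optimal_ratio P S0 D in
  (forall g : X -> R * R, measurable_fun setT g -> (forall s, D s (g s)) ->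
    \int[P]_w (g (S0 w)).2 - s * \int[P]_w (g (S0 w)).1 <= 0) /\
  (forall v : X -> R, P.-integrable setT (EFin \o (fun w => v (S0 w))) ->
    (exists2 g : X -> R * R, measurable_fun setT g & forall s, D s (g s)) ->
    (forall x q, D x q -> q.2 - s * q.1 <= v x) ->
    0 <= \int[P]_w v (S0 w)).
Proof.
move=> s.
have ratioP : one_shot_expectations P S0 D !=set0 ->
    (forall p, one_shot_expectations P S0 D p -> p.2 - s * p.1 <= 0) /\
    (forall c, (forall p, one_shot_expectations P S0 D p ->
      p.2 - s * p.1 <= - c) -> c <= 0).
  move=> A0; apply: (sup_ratio_closure envelopeL_gt0 A0
    (K := \int[P]_w (1 + M (S0 w)))) => p /one_shot_bounds[p1 p2].
  split=> //.
  have := p2 0 (fun x => 1 + M x) integrable_envelopeM.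
  rewrite mul0r subr0; apply => x q /envelope_snd; rewrite mul0r subr0.
  by apply: le_trans; rewrite ler_norm.
split.
  move=> g mg Dg; have Ag := one_shot_rule mg Dg.
  by have [/(_ _ Ag)] := ratioP (ex_intro _ _ Ag).
move=> v iv [g mg Dg] vD.
have [_] := ratioP (ex_intro _ _ (one_shot_rule mg Dg)).
move=> /(_ (- \int[P]_w v (S0 w))); rewrite opprK oppr_le0; apply.
by move=> p /one_shot_bounds[_]; exact.
Qed.

End one_shot.

(** * Recursions driven by the states *)

Lemma proj_itv_id (R : realType) (a b x : R) : a <= x <= b ->
  proj_itv a b x = x.
Proof.
by move=> /andP[ax xb]; rewrite /proj_itv (min_idPl xb) (max_idPr ax).
Qed.

Lemma measurable_proj_itv (R : realType) (a b : R) :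
  measurable_fun setT (proj_itv a b).
Proof. by apply: measurable_maxr => //; exact: measurable_minr. Qed.

Section adaptive_process.
Context d dX (Omega : measurableType d) (X : measurableType dX) (R : realType).
Variables (P : probability Omega R) (S : nat -> Omega -> X).
Hypothesis iidS : iid P S.
Variables (lo hi s : R) (lohi : lo <= s <= hi).

Let proj := proj_itv lo hi.

Let mS k : measurable_fun setT (S k).
Proof. by have [] := iidS. Qed.

Let eqS k B : measurable B -> P (S k @^-1` B) = P (S 0%N @^-1` B).
Proof. by have [_ _] := iidS; exact. Qed.

Let proj_in z : lo <= proj z <= hi.
Proof. by apply: proj_itv_in; case/andP: lohi => /le_trans; exact. Qed.

Let projE z : lo <= z <= hi -> proj z = z := @proj_itv_id R lo hi z.

(** This allows the projection to be dropped when the squared error of the next estimate is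
    expanded. *)
Lemma proj_itv_dist z : `|proj z - s| <= `|z - s|.
Proof.
have [lz|zl] := leP lo z; last first.
  rewrite /proj /proj_itv minEle; case: ifPn => [zh|/negP zh].
    rewrite (max_idPl (ltW zl)); case/andP: lohi => ls _.
    by rewrite !ler0_norm; lra.
  by case/andP: lohi => ls sh; exfalso; apply: zh; lra.
have [zh|hz] := leP z hi; first by rewrite projE ?lz.
rewrite /proj /proj_itv (min_idPr (ltW hz)); case/andP: lohi => ls sh.
rewrite (max_idPr (le_trans ls sh)) !ger0_norm; lra.
Qed.

Let measurable_proj : measurable_fun setT proj := @measurable_proj_itv R lo hi.

(** With [eta = 1 / ((k + 2) tau)], the drift contracts the mean squared error by
    [1 - 2 eta tau = k / (k + 2)], while the noise adds at most [eta^2 C]. Such a recursion decays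
    like [1 / (k + 1)]. *)
Lemma mean_square_rate (theta : nat -> Omega -> R) (x : nat -> R * X -> R)
    (theta0 tau C : R) : 0 < tau -> lo <= theta0 <= hi ->
  (forall k, measurable_fun setT (x k)) ->
  (forall w, theta 0%N w = theta0) ->
  (forall k w, theta k.+1 w = proj_itv lo hi
    (theta k w + 1 / ((k%:R + 2) * tau) * x k (theta k w, S k w))) ->
  (forall k, (\int[P]_w (x k (theta k w, S k w) ^+ 2)%:E <= C%:E)%E) ->
  (forall k z, lo <= z <= hi ->
    sq_integrable P (fun w => x k (z, S 0%N w)) /\
    (z - s) * \int[P]_w x k (z, S 0%N w) <= - tau * (z - s) ^+ 2) ->
  exists2 B, 0 <= B &
    forall k, \int[P]_w ((theta k w - s) ^+ 2) <= B / k.+1%:R.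
Proof.
move=> tau0 th0 mx theta_0 theta_S xC xz.
have mstep k : measurable_fun setT (fun p : R * X =>
    proj_itv lo hi (p.1 + 1 / ((k%:R + 2) * tau) * x k p)).
  apply: measurableT_comp; first exact: measurable_proj.
  apply: measurable_funD; first exact: measurable_fst.
  exact: measurable_funM.
have [_ indepS _] := iidS.
have ZP k := recursion_indep mS indepS mstep theta_0 theta_S k.
have mth k : measurable_fun setT (theta k) by case: (ZP k).
have thin k w : lo <= theta k w <= hi.
  by case: k => [|k]; [rewrite theta_0|rewrite theta_S; exact: proj_in].
have sqth k : sq_integrable P (fun w => theta k w - s).
  apply: (@sq_integrable_bounded _ _ _ _ _ (hi - lo)).
    exact: measurable_funB.
  move=> w; have /andP[? ?] := thin k w; case/andP: lohi => ? ?.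
  by rewrite ler_norml; lra.
pose xi k w := x k (theta k w, S k w).
have mxi k : measurable_fun setT (xi k).
  by apply: measurableT_comp => //; exact: measurable_fun_pair.
have sqxi k : sq_integrable P (xi k) by exact: sq_integrableP (mxi k) (xC k).
pose e k := \int[P]_w ((theta k w - s) ^+ 2).
have cross k : \int[P]_w ((theta k w - s) * xi k w) <= - tau * e k.
  have sq2 : P.-integrable setT (EFin \o (fun w => (theta k w - s) ^+ 2)).
    by have [] := sqth k.
  rewrite /e -RintegralZl//.
  (* The drift bound is known only on [[lo, hi]], whereas freezing requires it for every real [z].
     Inserting [proj] extends it and changes nothing along the run, which stays in the interval. *)
  have -> : \int[P]_w ((theta k w - s) * xi k w) =
      \int[P]_w ((proj (theta k w) - s) * x k (proj (theta k w), S k w)).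
    by apply: eq_Rintegral => w _; rewrite projE.
  have -> : \int[P]_w (- tau * (theta k w - s) ^+ 2) =
      \int[P]_w (- tau * (proj (theta k w) - s) ^+ 2).
    by apply: eq_Rintegral => w _; rewrite projE.
  apply: (@indep_Rintegral_le _ _ _ _ _ _ _ P (theta k) (S k) (S 0%N)
    (fun p => (proj p.1 - s) * x k (proj p.1, p.2))
    (fun z => - tau * (proj z - s) ^+ 2)) => //=.
  - by case: (ZP k).
  - by move=> B; exact: eqS.
  - apply: measurable_funM.
      by apply: measurable_funB => //; exact: measurableT_comp.
    apply: measurableT_comp => //; apply: measurable_fun_pair => //.
    exact: measurableT_comp.
  - apply: measurable_funM => //; apply: measurable_funX.
    exact: measurable_funB.
  - have := sq_integrableM (sqth k) (sqxi k).
    by apply: eq_integrable => // w _ /=; rewrite projE.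
  - have := integrableZ_real (- tau) sq2.
    by apply: eq_integrable => // w _ /=; rewrite projE.
  - move=> z; apply: integrableZ_real; apply: sq_integrable_integrable.
    by have [] := xz k _ (proj_in z).
  - move=> z; rewrite RintegralZl//; first by have [] := xz k _ (proj_in z).
    by apply: sq_integrable_integrable; have [] := xz k _ (proj_in z).
have C0 : 0 <= C.
  rewrite -lee_fin; apply: le_trans (xC 0%N).
  by apply: integral_ge0 => w _; rewrite lee_fin sqr_ge0.
have xiC k : \int[P]_w (xi k w ^+ 2) <= C.
  rewrite -lee_fin /Rintegral fineK; first exact: xC.
  by apply: integrable_fin_num => //; have [] := sqxi k.
have rec k : e k.+1 <= (1 - 2 / (k%:R + 2)) * e k +
    C / tau ^+ 2 / (k%:R + 2) ^+ 2.
  set eta := 1 / ((k%:R + 2) * tau).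
  have k2 : 0 < k%:R + 2 :> R by rewrite ltr_wpDl.
  have eta0 : 0 <= eta by apply/ltW/divr_gt0 => //; exact: mulr_gt0.
  have isq := (sqth k).2; have ixi := (sqxi k).2.
  have icr := sq_integrableM (sqth k) (sqxi k).
  have i1 := integrableZ_real (2 * eta) icr.
  have i2 := integrableZ_real (eta ^+ 2) ixi.
  have i12 := integrableD_real i1 i2.
  apply: (@le_trans _ _ (\int[P]_w ((theta k w - s) ^+ 2 +
      (2 * eta * ((theta k w - s) * xi k w) + eta ^+ 2 * xi k w ^+ 2)))).
    apply: le_Rintegral => //.
    - by have [] := sqth k.+1.
    - exact: integrableD_real.
    - move=> w _; rewrite theta_S -/eta -/(xi k w).
      have := proj_itv_dist (theta k w + eta * xi k w).
      rewrite -/(proj _) -(@ler_pXn2r _ 2)// ?nnegrE// !real_normK ?num_real//.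
      move/le_trans; apply; rewrite le_eqVlt; apply/orP; left; apply/eqP.
      by ring.
  rewrite RintegralD// RintegralD// !RintegralZl// -/(e k).
  have -> : C / tau ^+ 2 / (k%:R + 2) ^+ 2 = eta ^+ 2 * C.
    by rewrite /eta; field; rewrite !gt_eqF.
  have -> : (1 - 2 / (k%:R + 2)) * e k = e k + 2 * eta * (- tau * e k).
    by rewrite /eta; field; rewrite !gt_eqF.
  rewrite -addrA lerD2l lerD//.
    by rewrite ler_wpM2l// mulr_ge0.
  by rewrite ler_wpM2l// sqr_ge0.
have e0_ge0 : 0 <= e 0%N by apply: Rintegral_ge0 => w _; exact: sqr_ge0.
have D0 : 0 <= C / tau ^+ 2 by rewrite divr_ge0 ?sqr_ge0.
(* The summand [e 0] starts the induction and [C / tau ^+ 2] pays for the noise; the induction step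
   leaves the explicit nonnegative remainder computed at its end. *)
exists (e 0%N + C / tau ^+ 2); first exact: addr_ge0.
move=> k; rewrite -/(e k).
elim: k => [|k IH]; first by rewrite divr1 lerDl.
apply: (le_trans (rec k)).
set D := C / tau ^+ 2 in D0 IH *; set E := e 0%N in e0_ge0 IH *.
move: (e k) IH => ek IH.
have kE : k.+1%:R = k%:R + 1 :> R by rewrite -natr1.
have kE2 : k.+2%:R = k%:R + 2 :> R by rewrite -addn2 natrD.
rewrite kE2; rewrite kE in IH.
have k0 : 0 <= k%:R :> R by [].
move: (k%:R : R) k0 IH => y y0 IH.
have y1 : 0 < y + 1 by lra.
have y2 : 0 < y + 2 by lra.
have -> : 1 - 2 / (y + 2) = y / (y + 2) by field; rewrite gt_eqF.
apply: (@le_trans _ _ (y / (y + 2) * ((E + D) / (y + 1)) + D / (y + 2) ^+ 2)).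
  by rewrite lerD2r ler_wpM2l// divr_ge0// ltW.
rewrite -subr_ge0.
have -> : (E + D) / (y + 2) - (y / (y + 2) * ((E + D) / (y + 1)) +
    D / (y + 2) ^+ 2) = (E * (y + 2) + D) / ((y + 1) * (y + 2) ^+ 2).
  by field; rewrite !gt_eqF.
apply: divr_ge0; last by apply: mulr_ge0; [exact: ltW|exact: sqr_ge0].
by apply: addr_ge0 => //; apply: mulr_ge0 => //; exact: ltW.
Qed.

(** The weight [max(sigma, 0)] is nonnegative and known before the current state, so an upper bound
    on the drift is enough to control the cross term. The drift [c |theta - s|] is of order
    [k^(-1/2)] in mean square, just small enough for second moments to grow linearly. *)
Lemma sublinear_positive_part (theta : nat -> Omega -> R)
    (step : nat -> R * X -> R) (w : nat -> R * X -> R) (theta0 B C c : R) :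
  0 <= B -> 0 <= c ->
  (forall k, measurable_fun setT (step k)) ->
  (forall k, measurable_fun setT (w k)) ->
  (forall o, theta 0%N o = theta0) ->
  (forall k o, theta k.+1 o = step k (theta k o, S k o)) ->
  (forall k o, lo <= theta k o <= hi) ->
  (forall k, \int[P]_o ((theta k o - s) ^+ 2) <= B / k.+1%:R) ->
  (forall k, (\int[P]_o (w k (theta k o, S k o) ^+ 2)%:E <= C%:E)%E) ->
  (forall k z, lo <= z <= hi ->
    sq_integrable P (fun o => w k (z, S 0%N o)) /\
    \int[P]_o w k (z, S 0%N o) <= c * `|z - s|) ->
  {ae P, forall o, Num.max (\sum_(0 <= k < K) w k (theta k o, S k o)) 0 / K%:R
    @[K --> \oo] --> 0}.
Proof.
move=> B0 c0 mstep mw theta_0 theta_S thin rate wC wz.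
pose sigma K o := \sum_(0 <= k < K) w k (theta k o, S k o).
pose psi k (p : (R * R) * X) :=
  (step k (p.1.1, p.2), p.1.2 + w k (p.1.1, p.2)).
(* The estimate and the partial sum are run as one recursion, so that both together are independent
   of the current state. *)
pose Z k o := (theta k o, sigma k o).
have mpsi k : measurable_fun setT (psi k).
  have m11 : measurable_fun setT (fun p : (R * R) * X => (p.1.1, p.2)).
    apply: measurable_fun_pair => //; apply: measurableT_comp => //.
  apply: measurable_fun_pair; first exact: measurableT_comp.
  apply: measurable_funD; last exact: measurableT_comp.
  exact: measurableT_comp.
have Z0 o : Z 0%N o = (theta0, 0) by rewrite /Z theta_0 /sigma big_geq.
have ZS k o : Z k.+1 o = psi k (Z k o, S k o).
  by rewrite /Z /psi/= theta_S /sigma big_nat_recr.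
have [_ indepS _] := iidS.
have ZP k := recursion_indep mS indepS mpsi Z0 ZS k.
have mth k : measurable_fun setT (theta k).
  by apply: (measurableT_comp measurable_fst (ZP k).1).
have msigma k : measurable_fun setT (sigma k).
  by apply: (measurableT_comp measurable_snd (ZP k).1).
pose W k o := w k (theta k o, S k o).
have mW k : measurable_fun setT (W k).
  by apply: measurableT_comp => //; exact: measurable_fun_pair.
have sqW k : sq_integrable P (W k) by exact: sq_integrableP (mW k) (wC k).
pose A k o := Num.max (sigma k o) 0.
have mA k : measurable_fun setT (A k) by exact: measurable_maxr.
have A0 k o : 0 <= A k o by rewrite le_max lexx orbT.
have AS k o : `|A k.+1 o - A k o| <= `|W k o|.
  rewrite /A /sigma big_nat_recr//= -/(sigma k o) -/(W k o) !maxEle.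
  case: ifPn; rewrite -?ltNge; case: ifPn; rewrite -?ltNge;
    rewrite !ler_norml; have := ler_norm (W k o);
    have := ler_norm (- W k o); rewrite normrN; lra.
(* The right side is [(A k + W k)^2]. When the new sum is positive it is at most [A k + W k];
   otherwise [A k.+1] is [0]. *)
have AS2 k o : A k.+1 o ^+ 2 <= A k o ^+ 2 + (2 * (A k o * W k o) + W k o ^+ 2).
  rewrite [A k.+1 o]/A /sigma big_nat_recr//= -/(sigma k o) -/(W k o).
  rewrite maxEle; case: ifPn; rewrite -?ltNge => sW.
    by rewrite expr0n/=; have := sqr_ge0 (A k o + W k o); lra.
  have : sigma k o <= A k o by rewrite le_max lexx.
  by have := A0 k o; nra.
have sqWn k : sq_integrable P (fun o => `|W k o|).
  apply: sq_integrable_le (sqW k) => [|o]; last by rewrite normr_id.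
  exact: measurableT_comp.
have sqA k : sq_integrable P (A k).
  elim: k => [|k IH].
    apply: sq_integrable_le (sq_integrable_cst P 0) => // o.
    by rewrite /A /sigma big_geq// maxxx.
  apply: sq_integrable_le (sq_integrableD IH (sqWn k)) => // o.
  have := AS k o; rewrite ler_norml => /andP[_ AW].
  rewrite [leLHS]ger0_norm// [leRHS]ger0_norm; first by rewrite -lerBlDl.
  by rewrite addr_ge0.
have sqth k : sq_integrable P (fun o => theta k o - s).
  apply: (@sq_integrable_bounded _ _ _ _ _ (hi - lo)).
    exact: measurable_funB.
  move=> o; have /andP[? ?] := thin k o; case/andP: lohi => ? ?.
  by rewrite ler_norml; lra.
have sqth' k : sq_integrable P (fun o => `|theta k o - s|).
  apply: sq_integrable_le (sqth k) => [|o]; last by rewrite normr_id.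
  by apply: measurableT_comp => //; exact: measurable_funB.
have iAth k := sq_integrableM (sqA k) (sqth' k).
have iAW k := sq_integrableM (sqA k) (sqW k).
pose V k := \int[P]_o (A k o ^+ 2).
have cross k : \int[P]_o (A k o * W k o) <=
    \int[P]_o (c * (A k o * `|theta k o - s|)).
  have -> : \int[P]_o (A k o * W k o) = \int[P]_o
      (Num.max (Z k o).2 0 * w k (proj (Z k o).1, S k o)).
    by apply: eq_Rintegral => o _; rewrite /= projE.
  have -> : \int[P]_o (c * (A k o * `|theta k o - s|)) = \int[P]_o
      (c * (Num.max (Z k o).2 0 * `|proj (Z k o).1 - s|)).
    by apply: eq_Rintegral => o _; rewrite /= projE.
  apply: (@indep_Rintegral_le _ _ _ _ _ _ _ P (Z k) (S k) (S 0%N)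
    (fun p => Num.max p.1.2 0 * w k (proj p.1.1, p.2))
    (fun z => c * (Num.max z.2 0 * `|proj z.1 - s|))) => //=.
  - by case: (ZP k).
  - by case: (ZP k).
  - by move=> D; exact: eqS.
  - apply: measurable_funM.
      by apply: measurable_maxr => //; exact: measurableT_comp.
    apply: measurableT_comp => //; apply: measurable_fun_pair => //.
    by apply: measurableT_comp => //; exact: measurableT_comp.
  - apply: measurable_funM => //; apply: measurable_funM.
      exact: measurable_maxr.
    apply: measurableT_comp => //; apply: measurable_funB => //.
    exact: measurableT_comp.
  - by apply: eq_integrable (iAW k) => // o _ /=; rewrite projE.
  - have := integrableZ_real c (iAth k).
    by apply: eq_integrable => // o _ /=; rewrite projE.
  - move=> z; apply: integrableZ_real; apply: sq_integrable_integrable.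
    by have [] := wz k _ (proj_in z.1).
  - move=> z; have [sqz le_z] := wz k _ (proj_in z.1).
    rewrite RintegralZl//; last exact: sq_integrable_integrable.
    by rewrite mulrCA ler_wpM2l// le_max lexx orbT.
have C0 : 0 <= C.
  rewrite -lee_fin; apply: le_trans (wC 0%N).
  by apply: integral_ge0 => o _; rewrite lee_fin sqr_ge0.
have WC k : \int[P]_o (W k o ^+ 2) <= C.
  rewrite -lee_fin /Rintegral fineK; first exact: wC.
  by apply: integrable_fin_num => //; have [] := sqW k.
(* Young: [2 c A |t| <= A^2 / (2 n) + 2 c^2 n t^2] with [n = k + 1] *)
have young k : 2 * \int[P]_o (c * (A k o * `|theta k o - s|)) <=
    V k / (2 * k.+1%:R) + 2 * c ^+ 2 * B.
  set n := k.+1%:R : R; have n0 : 0 < n by rewrite ltr0n.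
  have i1 := integrableZ_real (2 * n)^-1 (sqA k).2.
  have i2 := integrableZ_real (2 * c ^+ 2 * n) (sqth k).2.
  rewrite -RintegralZl//; last exact: integrableZ_real.
  apply: (@le_trans _ _ (\int[P]_o ((2 * n)^-1 * A k o ^+ 2 +
      2 * c ^+ 2 * n * (theta k o - s) ^+ 2))).
    apply: le_Rintegral => //.
    - by apply: integrableZ_real; exact: integrableZ_real.
    - exact: integrableD_real.
    - move=> o _; rewrite -(real_normK (num_real (theta k o - s))).
      set a := A k o; set t := `|_|.
      have -> : (2 * n)^-1 * a ^+ 2 + 2 * c ^+ 2 * n * t ^+ 2 =
          2 * (c * (a * t)) + (2 * n)^-1 * (a - 2 * n * c * t) ^+ 2.
        by field; rewrite gt_eqF.
      by rewrite lerDl mulr_ge0 ?sqr_ge0// invr_ge0 mulr_ge0// ltW.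
  have jA := (sqA k).2; have jt := (sqth k).2.
  rewrite RintegralD// !RintegralZl//.
  rewrite -/(V k) mulrC lerD2l -[leRHS]/(2 * c ^+ 2 * B).
  apply: (@le_trans _ _ (2 * c ^+ 2 * n * (B / n))).
    apply: ler_wpM2l; last exact: rate.
    by apply: mulr_ge0 (ltW n0); rewrite mulr_ge0 ?sqr_ge0.
  by rewrite le_eqVlt; apply/orP; left; apply/eqP; field; rewrite gt_eqF.
have rec k : V k.+1 <= V k + (V k / (2 * k.+1%:R) + 2 * c ^+ 2 * B + C).
  have i1 := integrableZ_real 2 (iAW k).
  have i12 := integrableD_real i1 (sqW k).2.
  apply: (@le_trans _ _ (\int[P]_o (A k o ^+ 2 +
      (2 * (A k o * W k o) + W k o ^+ 2)))).
    apply: le_Rintegral => //; first exact: (sqA k.+1).2.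
    exact: integrableD_real (sqA k).2 i12.
  rewrite RintegralD//; last exact: (sqA k).2.
  rewrite RintegralD//; last exact: (sqW k).2.
  rewrite -/(V k) RintegralZl// lerD2l lerD//.
  by apply: le_trans (young k); rewrite ler_wpM2l.
(* Chosen so that each step adds at most [B2]: if [V k <= B2 k], then [V k / (2 (k + 1)) <= B2 / 2],
   and the constant terms are exactly the other half. *)
set B2 := 2 * (2 * c ^+ 2 * B + C).
have B20 : 0 <= B2 by rewrite mulr_ge0// addr_ge0// !mulr_ge0// sqr_ge0.
have VB k : V k <= B2 * k%:R.
  elim: k => [|k IH].
    rewrite mulr0 /V /A /sigma; under eq_Rintegral do rewrite big_geq// maxxx.
    by rewrite expr0n/= Rintegral_cst_probability.
  apply: (le_trans (rec k)).
  have -> : B2 * k.+1%:R = B2 * k%:R + (B2 / 2 + B2 / 2).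
    by rewrite -natr1; field.
  rewrite lerD// -addrA lerD//; last by rewrite /B2; lra.
  rewrite ler_pdivrMr ?mulr_gt0// (le_trans IH)//.
  have -> : B2 / 2 * (2 * k.+1%:R) = B2 * k.+1%:R by field.
  by rewrite ler_wpM2l// ler_nat.
apply: (@ae_sublinear _ _ _ P A W (B2 + C)) => //.
- move=> k; have := VB k; rewrite -lee_fin /V /Rintegral fineK; last first.
    by apply: integrable_fin_num => //; exact: (sqA k).2.
  by move=> /le_trans; apply; rewrite lee_fin ler_wpM2r// lerDl.
- by move=> k; apply: (le_trans (wC k)); rewrite lee_fin lerDr.
Qed.

End adaptive_process.

(** * The ratio-tracking algorithm *)

(** Integrates [(p + K q)^2 <= 2 p^2 + 2 K^2 q^2]. The extended-real integrals spare any
    integrability assumption. *)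
Lemma integral_sqr_le d (Omega : measurableType d) (R : realType)
    (P : probability Omega R) (A B Y : Omega -> R) (a b K : R) :
  measurable_fun setT A -> measurable_fun setT B -> measurable_fun setT Y ->
  0 <= K -> (forall w, `|Y w| <= `|A w| + K * `|B w|) ->
  (\int[P]_w (A w ^+ 2)%:E <= a%:E)%E -> (\int[P]_w (B w ^+ 2)%:E <= b%:E)%E ->
  (\int[P]_w (Y w ^+ 2)%:E <= (2 * a + 2 * K ^+ 2 * b)%:E)%E.
Proof.
move=> mA mB mY K0 YAB Aa Bb.
have mA2 : measurable_fun setT (fun w => A w ^+ 2) by exact: measurable_funX.
have mB2 : measurable_fun setT (fun w => B w ^+ 2) by exact: measurable_funX.
have mA2' : measurable_fun setT (fun w => 2 * A w ^+ 2).
  exact: measurable_funM.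
have mB2' : measurable_fun setT (fun w => 2 * K ^+ 2 * B w ^+ 2).
  exact: measurable_funM.
have K20 : 0 <= 2 * K ^+ 2 by rewrite mulr_ge0 ?sqr_ge0.
apply: (@le_trans _ _ (\int[P]_w (2 * A w ^+ 2 + 2 * K ^+ 2 * B w ^+ 2)%:E)%E).
  apply: ge0_le_integral => //.
  - by move=> w _; rewrite lee_fin sqr_ge0.
  - by apply/measurable_EFinP; exact: measurable_funX.
  - by apply/measurable_EFinP; exact: measurable_funD.
  - move=> w _; rewrite lee_fin -(real_normK (num_real (Y w))).
    rewrite -(real_normK (num_real (A w))) -(real_normK (num_real (B w))).
    have := YAB w; have := normr_ge0 (Y w).
    move: `|Y w| `|A w| `|B w| => y p q y0 ypq.
    have := sqr_ge0 (p - K * q); nra.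
rewrite ge0_integralD_real//; last 2 first.
- by move=> w; rewrite mulr_ge0 ?sqr_ge0.
- by move=> w; rewrite mulr_ge0 ?sqr_ge0.
rewrite !ge0_integralZl_real//; try by move=> w; exact: sqr_ge0.
rewrite (EFinD (2 * a)); apply: leeD.
  by rewrite (EFinM 2 a); apply: lee_wpmul2l; rewrite ?lee_fin.
by rewrite (EFinM (2 * K ^+ 2) b); apply: lee_wpmul2l; rewrite ?lee_fin.
Qed.

(** A deterministic fact: the first two limits make [sum r - s * sum t] sublinear, and the third
    keeps [sum t] above a positive multiple of [K]. *)
Lemma ratio_of_sums_cvg (R : realType) (t r : nat -> R) (s tau : R) : 0 < tau ->
  Num.max (\sum_(0 <= k < K) (r k - s * t k)) 0 / K%:R @[K --> \oo] --> 0 ->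
  Num.max (\sum_(0 <= k < K) (s * t k - r k)) 0 / K%:R @[K --> \oo] --> 0 ->
  Num.max (\sum_(0 <= k < K) (tau - t k)) 0 / K%:R @[K --> \oo] --> 0 ->
  (\sum_(0 <= k < K) r k) / (\sum_(0 <= k < K) t k) @[K --> \oo] --> s.
Proof.
move=> tau0 /cvgr0Pnorm_lt Hp /cvgr0Pnorm_lt Hm /cvgr0Pnorm_lt Ht.
apply/cvgrPdist_lt => e e0.
(* Eventually the numerator of the error is below [(tau e / 2) K] and the denominator above
   [(tau / 2) K], whose quotient is [e]. *)
have d0 : 0 < tau * e / 2 by rewrite divr_gt0 ?mulr_gt0.
have t0 : 0 < tau / 2 by rewrite divr_gt0.
have upper (u : nat -> R) c K : 0 < K%:R :> R ->
    `|Num.max (\sum_(0 <= k < K) u k) 0 / K%:R| < c ->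
    \sum_(0 <= k < K) u k < c * K%:R.
  move=> K0 /ltr_normlW; rewrite ltr_pdivrMr//.
  by apply: le_lt_trans; rewrite le_max lexx.
near=> K.
have K0 : 0 < K%:R :> R by rewrite ltr0n; near: K; exact: nbhs_infty_gt.
have HpK : `|Num.max (\sum_(0 <= k < K) (r k - s * t k)) 0 / K%:R|
    < tau * e / 2.
  by near: K; exact: Hp.
have HmK : `|Num.max (\sum_(0 <= k < K) (s * t k - r k)) 0 / K%:R|
    < tau * e / 2.
  by near: K; exact: Hm.
have HtK : `|Num.max (\sum_(0 <= k < K) (tau - t k)) 0 / K%:R| < tau / 2.
  by near: K; exact: Ht.
move: HpK HmK HtK => /(upper _ _ _ K0) + /(upper _ _ _ K0) + /(upper _ _ _ K0).
rewrite !sumrB -!mulr_sumr sumr_const_nat subn0 -mulr_natr.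
set sr := \sum_(0 <= k < K) r k; set st := \sum_(0 <= k < K) t k.
move=> Hp' Hm' Ht'.
have st_gt : tau / 2 * K%:R < st by lra.
have st0 : 0 < st by rewrite (lt_trans _ st_gt)// mulr_gt0.
have -> : s - sr / st = (s * st - sr) / st by field; rewrite gt_eqF.
rewrite normrM normfV (gtr0_norm st0) ltr_pdivrMr//.
apply: (@lt_trans _ _ (tau * e / 2 * K%:R)).
  by rewrite ltr_norml; lra.
by nra.
Unshelve. all: by end_near.
Qed.

(** * The maximizing rule at a frozen estimate *)

Section rule.
Context d dX (Omega : measurableType d) (X : measurableType dX) (R : realType).
Variables (P : probability Omega R) (S : nat -> Omega -> X).
Variables (D : X -> set (R * R)) (L M : X -> R).
Variables (Tmin Tmax Rmin Rmax C1 C2 thmin thmax : R).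
Hypotheses (iidS : iid P S) (Dset : decision_sets D)
  (env : moment_envelope P (S 0%N) D L M) (Tmin_gt0 : 0 < Tmin)
  (ub : uniform_bounds P S D Tmin Tmax Rmin Rmax C1 C2).
Let s := optimal_ratio P (S 0%N) D.
Hypothesis s_in : thmin <= s <= thmax.
Variable f : R * X -> R * R.
Hypothesis max_f : maximizing_rule thmin thmax D f.

Let mS k : measurable_fun setT (S k).
Proof. by have [] := iidS. Qed.

(** [f] is measurable only over [[thmin, thmax]]; projecting its first argument gives a function
    measurable everywhere. *)
Lemma measurable_rule : measurable_fun setT
  (fun p : R * X => f (proj_itv thmin thmax p.1, p.2)).
Proof.
have [mf _] := max_f.
apply: (measurable_comp _ _ mf) => //.
- exact: measurableX.
- move=> _ [p _ <-]; split=> //=.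
  by rewrite in_itv/= proj_itv_in//; case/andP: s_in => /le_trans; exact.
- apply: measurable_fun_pair => //.
  by apply: measurableT_comp => //; exact: measurable_proj_itv.
Qed.

Lemma measurable_rule_at z : thmin <= z <= thmax ->
  measurable_fun setT (fun x => f (z, x)).
Proof.
move=> zin; have := measurable_fun_pair2 z measurable_rule.
by rewrite /= proj_itv_id.
Qed.

Let in_D z x : thmin <= z <= thmax -> D x (f (z, x)).
Proof. by move=> /(max_f.2 z x)[]. Qed.

Let D0 x : D x !=set0. Proof. by exists (f (s, x)); exact: in_D. Qed.

Section fixed_estimate.
Variable z : R.
Hypothesis z_in : thmin <= z <= thmax.

(** With the estimate frozen, the rule is a feasible choice on frame [0], so the uniform moment
    bounds apply to it. *)
Let feas : feasible D (S 0%N) (fun w => (f (z, S 0%N w)).1)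
  (fun w => (f (z, S 0%N w)).2).
Proof.
have mfz : measurable_fun setT (fun w => f (z, S 0%N w)).
  exact: (measurableT_comp (measurable_rule_at z_in) (mS 0%N)).
split; [exact: measurableT_comp|exact: measurableT_comp|move=> w].
by rewrite -surjective_pairing; exact: in_D.
Qed.

Lemma sq_integrable_rule_fst :
  sq_integrable P (fun w => (f (z, S 0%N w)).1).
Proof.
have [mT _ _] := feas; have [_ _ + _] := ub feas.
by rewrite unlock; exact: sq_integrableP.
Qed.

Lemma sq_integrable_rule_snd :
  sq_integrable P (fun w => (f (z, S 0%N w)).2).
Proof.
have [_ mR _] := feas; have [_ _ _ +] := ub feas.
by rewrite unlock; exact: sq_integrableP.
Qed.

Lemma rule_fst_bounds :
  Tmin <= \int[P]_w (f (z, S 0%N w)).1 <= Tmax.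
Proof.
have [+ _ _ _] := ub feas; rewrite unlock -!lee_fin /Rintegral fineK//.
exact: integrable_fin_num (sq_integrable_integrable sq_integrable_rule_fst).
Qed.

End fixed_estimate.

(** The function [v] of the overview is [v(z) = r z - z * t z]. *)
Let t z := \int[P]_w (f (z, S 0%N w)).1.
Let r z := \int[P]_w (f (z, S 0%N w)).2.

Let it z (zi : thmin <= z <= thmax) :=
  sq_integrable_integrable (sq_integrable_rule_fst zi).
Let ir z (zi : thmin <= z <= thmax) :=
  sq_integrable_integrable (sq_integrable_rule_snd zi).

Let optP := optimal_ratioP (mS 0) Dset env D0.

Let rule_le0 z : thmin <= z <= thmax -> r z - s * t z <= 0.
Proof.
move=> zi; apply: (optP.1 (fun x => f (z, x))) => [|x]; last exact: in_D.
exact: measurable_rule_at.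
Qed.

(** At [z = s] the rule attains the pointwise maximum of [r - s t], so the second half of
    [optimal_ratioP] applies. Together with [rule_le0] this gives [v(s) = 0]. *)
Let rule_ge0 : 0 <= r s - s * t s.
Proof.
have iZ := integrableZ_real s (it s_in).
rewrite /r /t -RintegralZl//; last exact: it.
rewrite -RintegralB//; last exact: ir.
apply: (optP.2 (fun x => (f (s, x)).2 - s * (f (s, x)).1)).
- exact: (integrableB measurableT (ir s_in) iZ).
- exists (fun x => f (s, x)) => [|x]; last exact: in_D.
  exact: measurable_rule_at.
- by move=> x q; have [_] := max_f.2 s x s_in; exact.
Qed.

Let rule_max z : thmin <= z <= thmax -> r s - z * t s <= r z - z * t z.
Proof.
move=> zi; have iZs := integrableZ_real z (it s_in).
have iZz := integrableZ_real z (it zi).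
have is2 := ir s_in; have iz2 := ir zi; have is1 := it s_in; have iz1 := it zi.
rewrite /r /t -!RintegralZl// -!RintegralB//.
apply: le_Rintegral => //.
- exact: (integrableB measurableT is2 iZs).
- exact: (integrableB measurableT iz2 iZz).
- by move=> w _; have [_] := max_f.2 z (S 0%N w) zi; apply; exact: in_D.
Qed.

(** For [z >= s], [v(z) = (r z - s t z) - (z - s) t z <= - (z - s) Tmin] by optimality of [s]. For
    [z < s], comparison with the rule at [s] gives [v(z) >= r s - z t s >= (s - z) Tmin]. *)
Lemma rule_drift z : thmin <= z <= thmax ->
  (z - s) * \int[P]_w ((f (z, S 0%N w)).2 - z * (f (z, S 0%N w)).1) <=
  - Tmin * (z - s) ^+ 2.
Proof.
move=> zi; rewrite RintegralB//; [|exact: ir|exact: integrableZ_real (it zi)].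
rewrite RintegralZl//; last exact: it.
rewrite -/(r z) -/(t z).
have := rule_le0 zi; have := rule_ge0; have := rule_max zi.
have /andP[+ _] := rule_fst_bounds zi; have /andP[+ _] := rule_fst_bounds s_in.
rewrite -/(t z) -/(t s) => ts tz h1 h2 h3.
have [sz|zs] := leP s z.
  have : 0 <= (z - s) ^+ 2 * (t z - Tmin).
    by rewrite mulr_ge0 ?sqr_ge0 ?subr_ge0.
  have : (z - s) * (r z - s * t z) <= 0 by rewrite mulr_ge0_le0// subr_ge0.
  move: h1 h2 h3 sz ts tz; move: (t z) (r z) (t s) (r s) s => tz rz ts rs a.
  by move=> *; nra.
have : 0 <= (s - z) ^+ 2 * (t s - Tmin) by rewrite mulr_ge0 ?sqr_ge0 ?subr_ge0.
have : 0 <= (s - z) * (r z - z * t z - (r s - z * t s)).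
  by rewrite mulr_ge0// subr_ge0// ltW.
have : 0 <= (s - z) * (r s - s * t s) by rewrite mulr_ge0// subr_ge0 ltW.
move: h1 h2 h3 zs ts tz; move: (t z) (r z) (t s) (r s) s => tz rz ts rs a.
by move=> *; nra.
Qed.

(** The integral is at most [0] by optimality of [s]. Comparison with the rule at [s] bounds it
    below by [(z - s) (t z - t s)], and both mean durations lie in [[0, Tmax]]. *)
Lemma rule_gap z : thmin <= z <= thmax ->
  `|\int[P]_w ((f (z, S 0%N w)).2 - s * (f (z, S 0%N w)).1)| <=
  Tmax * `|z - s|.
Proof.
move=> zi; rewrite RintegralB//; [|exact: ir|exact: integrableZ_real (it zi)].
rewrite RintegralZl//; last exact: it.
rewrite -/(r z) -/(t z).
have := rule_le0 zi; have := rule_ge0; have := rule_max zi.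
have /andP[] := rule_fst_bounds zi; have /andP[] := rule_fst_bounds s_in.
rewrite -/(t z) -/(t s) => ts1 ts2 tz1 tz2 h1 h2 h3.
rewrite ler0_norm//; have [sz|zs] := leP s z.
  have : 0 <= (z - s) * (Tmax - t s) by rewrite mulr_ge0// subr_ge0.
  have : 0 <= (z - s) * t z.
    by apply: mulr_ge0; [rewrite subr_ge0|exact: le_trans (ltW Tmin_gt0) tz1].
  rewrite ger0_norm ?subr_ge0//.
  move: h1 h2 h3; move: (t z) (r z) (t s) (r s) s => tz rz ts rs a.
  by move=> *; nra.
have : 0 <= (s - z) * (Tmax - t z) by rewrite mulr_ge0// subr_ge0// ltW.
have : 0 <= (s - z) * t s.
  apply: mulr_ge0; first by rewrite subr_ge0 ltW.
  exact: le_trans (ltW Tmin_gt0) ts1.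
rewrite ltr0_norm ?subr_lt0//.
move: h1 h2 h3; move: (t z) (r z) (t s) (r s) s => tz rz ts rs a.
by move=> *; nra.
Qed.

End rule.

(** * Convergence of the ratio of sums *)

Theorem theorem8 (R : realType) (d : measure_display)
    (Omega : measurableType d) (P : probability Omega R)
    (m : nat) (OmegaS : set (m.-tuple R)) (OmegaS0 : OmegaS !=set0)
    (S : nat -> Omega -> trace_space OmegaS0)
    (D : trace_space OmegaS0 -> set (R * R))
    (L M : trace_space OmegaS0 -> R)
    (Tmin Tmax Rmin Rmax C1 C2 thmin thmax theta0 : R)
    (f : nat -> R * trace_space OmegaS0 -> R * R)
    (theta T Rw : nat -> Omega -> R) :
  iid P S ->
  decision_sets D ->
  moment_envelope P (S 0%N) D L M ->
  0 < Tmin ->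
  uniform_bounds P S D Tmin Tmax Rmin Rmax C1 C2 ->
  thmin <= optimal_ratio P (S 0%N) D <= thmax ->
  thmin <= theta0 <= thmax ->
  (forall k, maximizing_rule thmin thmax D (f k)) ->
  algorithm_run thmin thmax theta0 (fun k => 1 / ((k%:R + 2) * Tmin))
    S f theta T Rw ->
  {ae P, forall w,
    (\sum_(0 <= k < K) Rw k w) / (\sum_(0 <= k < K) T k w)
      @[K --> \oo] --> optimal_ratio P (S 0%N) D}.
Proof.
move=> iidS Dset env Tmin0 ub s_in th0_in max_f [theta_0 TRE theta_S].
set s := optimal_ratio P (S 0%N) D in s_in *.
have thin k w : thmin <= theta k w <= thmax.
  case: k => [|k]; first by rewrite theta_0.
  by rewrite theta_S proj_itv_in//; case/andP: s_in => /le_trans; exact.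
have mS k : measurable_fun setT (S k) by have [] := iidS.
(* [g k] is a measurable extension of [f k] that agrees with it along the run, where the estimates
   stay in the interval. *)
pose g k (p : R * trace_space OmegaS0) := f k (proj_itv thmin thmax p.1, p.2).
have mg k : measurable_fun setT (g k).
  by apply: measurable_rule; [exact: s_in|exact: max_f].
have mg1 k : measurable_fun setT (fun p => (g k p).1).
  exact: measurableT_comp.
have mg2 k : measurable_fun setT (fun p => (g k p).2).
  exact: measurableT_comp.
have gE k w : g k (theta k w, S k w) = (T k w, Rw k w).
  by rewrite /g /= proj_itv_id ?thin// TRE.
have gzE k z x : thmin <= z <= thmax -> g k (z, x) = f k (z, x).
  by move=> zi; rewrite /g /= proj_itv_id.
have mproj : measurable_fun setT (fun p : R * trace_space OmegaS0 =>
    proj_itv thmin thmax p.1).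
  by apply: measurableT_comp => //; exact: measurable_proj_itv.
pose x k (p : R * trace_space OmegaS0) :=
  (g k p).2 - proj_itv thmin thmax p.1 * (g k p).1.
have mx k : measurable_fun setT (x k).
  by apply: measurable_funB => //; exact: measurable_funM.
have xE k w : x k (theta k w, S k w) = Rw k w - theta k w * T k w.
  by rewrite /x gE /= proj_itv_id.
pose step k (p : R * trace_space OmegaS0) := proj_itv thmin thmax
  (p.1 + 1 / ((k%:R + 2) * Tmin) * x k p).
have mstep k : measurable_fun setT (step k).
  apply: measurableT_comp; first exact: measurable_proj_itv.
  apply: measurable_funD; first exact: measurable_fst.
  exact: measurable_funM.
have theta_S' k w : theta k.+1 w = step k (theta k w, S k w).
  by rewrite theta_S /step /= xE.
have [_ indepS _] := iidS.
have mth k : measurable_fun setT (theta k).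
  by have [] := recursion_indep mS indepS mstep theta_0 theta_S' k.
have mp k : measurable_fun setT (fun w => (theta k w, S k w)).
  exact: measurable_fun_pair.
have TE k : T k = (fun w => (g k (theta k w, S k w)).1).
  by apply/funext => w; rewrite gE.
have RE k : Rw k = (fun w => (g k (theta k w, S k w)).2).
  by apply/funext => w; rewrite gE.
have mT k : measurable_fun setT (T k).
  by rewrite TE; exact: measurableT_comp (mg1 k) (mp k).
have mR k : measurable_fun setT (Rw k).
  by rewrite RE; exact: measurableT_comp (mg2 k) (mp k).
have feas k : feasible D (S k) (T k) (Rw k).
  split=> // w; rewrite TRE.
  by have [] := (max_f k).2 (theta k w) (S k w) (thin k w).
have TC k : (\int[P]_w (T k w ^+ 2)%:E <= C1%:E)%E.
  by have [_ _ + _] := ub k _ _ (feas k); rewrite unlock.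
have RC k : (\int[P]_w (Rw k w ^+ 2)%:E <= C2%:E)%E.
  by have [_ _ _ +] := ub k _ _ (feas k); rewrite unlock.
have sqf1 k z : thmin <= z <= thmax ->
    sq_integrable P (fun w => (f k (z, S 0%N w)).1).
  by move=> zi; exact: (sq_integrable_rule_fst iidS ub s_in (max_f k) zi).
have sqf2 k z : thmin <= z <= thmax ->
    sq_integrable P (fun w => (f k (z, S 0%N w)).2).
  by move=> zi; exact: (sq_integrable_rule_snd iidS ub s_in (max_f k) zi).
have Tmax0 : 0 <= Tmax.
  have /andP[h1 h2] := rule_fst_bounds iidS ub s_in (max_f 0%N) s_in.
  by rewrite (le_trans (ltW Tmin0))// (le_trans h1).
(* A bound on [|theta k|], used for the second moment of [R - theta T]. *)
pose K := `|thmin| + `|thmax|.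
have [B B0 rate] : exists2 B, 0 <= B &
    forall k, \int[P]_w ((theta k w - s) ^+ 2) <= B / k.+1%:R.
  apply: (mean_square_rate iidS s_in (x := x) (C := 2 * C2 + 2 * K ^+ 2 * C1)
    Tmin0 th0_in mx theta_0) => //.
  - move=> k; apply: (integral_sqr_le (mR k) (mT k)) => //.
    + by apply: (measurableT_comp (mx k) (mp k)).
    + by rewrite addr_ge0.
    + move=> w; rewrite xE; apply: (le_trans (ler_normB _ _)).
      rewrite lerD2l normrM ler_wpM2r//.
      have /andP[h1 h2] := thin k w.
      have := ler_norm thmax; have := ler_norm (- thmin); rewrite normrN.
      have := normr_ge0 thmin; have := normr_ge0 thmax.
      by rewrite /K ler_norml; lra.
  - move=> k z zi.
    have xzE : (fun w => x k (z, S 0%N w)) =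
        (fun w => (f k (z, S 0%N w)).2 - z * (f k (z, S 0%N w)).1).
      by apply/funext => w; rewrite /x gzE//= proj_itv_id.
    rewrite xzE; split.
      have := sq_integrableD (sqf2 k z zi) (sq_integrableZ (- z) (sqf1 k z zi)).
      by under eq_fun do rewrite mulNr.
    exact: (rule_drift iidS Dset env ub s_in (max_f k) zi).
(* Stated for all affine combinations so that [R - s T], its opposite and [Tmin - T] are three
   instances. *)
have main (a b c : R) :
    (forall k z, thmin <= z <= thmax -> \int[P]_w
      (a + b * ((f k (z, S 0%N w)).2) + c * ((f k (z, S 0%N w)).1)) <=
      Tmax * `|z - s|) ->
    {ae P, forall w, Num.max (\sum_(0 <= k < K) (a + b * Rw k w + c * T k w)) 0
      / K%:R @[K --> \oo] --> 0}.
  move=> abc.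
  pose w k (p : R * trace_space OmegaS0) := a + b * (g k p).2 + c * (g k p).1.
  have mw k : measurable_fun setT (w k).
    apply: measurable_funD; last exact: measurable_funM.
    by apply: measurable_funD => //; exact: measurable_funM.
  have wE k o : w k (theta k o, S k o) = a + b * Rw k o + c * T k o.
    by rewrite /w gE.
  have sumE o J : \sum_(0 <= k < J) (a + b * Rw k o + c * T k o) =
      \sum_(0 <= k < J) w k (theta k o, S k o).
    by apply: eq_bigr => k _; rewrite wE.
  suff : {ae P, forall o, Num.max (\sum_(0 <= k < J) w k (theta k o, S k o)) 0
      / J%:R @[J --> \oo] --> 0}.
    by apply: filterS => o; under eq_fun do rewrite -sumE.
  apply: (sublinear_positive_part iidS s_in (step := step) (w := w)
    (* The constant of [integral_sqr_le] applied twice: to [(a + b R) + c T], then to [a + b R]. *)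
    (C := 2 * (2 * a ^+ 2 + 2 * `|b| ^+ 2 * C2) + 2 * `|c| ^+ 2 * C1)
    B0 Tmax0 mstep mw theta_0 theta_S' thin rate).
  - move=> k.
    have mbR : measurable_fun setT (fun o => a + b * Rw k o).
      by apply: measurable_funD => //; exact: measurable_funM.
    apply: (integral_sqr_le mbR (mT k)) => //.
    + exact: measurableT_comp (mw k) (mp k).
    + by move=> o; rewrite wE -normrM ler_normD.
    + apply: (integral_sqr_le (A := fun=> a) _ (mR k)) => //.
      * by move=> o; rewrite -normrM ler_normD.
      * by rewrite integral_cst//= probability_setT mule1.
  - move=> k z zi.
    have wzE : (fun o => w k (z, S 0%N o)) = (fun o =>
        a + b * (f k (z, S 0%N o)).2 + c * (f k (z, S 0%N o)).1).
      by apply/funext => o; rewrite /w gzE.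
    rewrite wzE; split.
      apply: sq_integrableD; last exact: sq_integrableZ (sqf1 k z zi).
      apply: sq_integrableD; first exact: sq_integrable_cst.
      exact: sq_integrableZ (sqf2 k z zi).
    exact: abc.
have gap k z : thmin <= z <= thmax ->
    `|\int[P]_w ((f k (z, S 0%N w)).2 - s * (f k (z, S 0%N w)).1)| <=
    Tmax * `|z - s|.
  by move=> zi; exact: (rule_gap iidS Dset env Tmin0 ub s_in (max_f k) zi).
suff [Hp Hm Ht] : [/\ forall k z, thmin <= z <= thmax -> \int[P]_w
      (0 + 1 * (f k (z, S 0%N w)).2 + - s * (f k (z, S 0%N w)).1) <=
      Tmax * `|z - s|,
    forall k z, thmin <= z <= thmax -> \int[P]_w
      (0 + -1 * (f k (z, S 0%N w)).2 + s * (f k (z, S 0%N w)).1) <=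
      Tmax * `|z - s|
  & forall k z, thmin <= z <= thmax -> \int[P]_w
      (Tmin + 0 * (f k (z, S 0%N w)).2 + -1 * (f k (z, S 0%N w)).1) <=
      Tmax * `|z - s|].
  move: (main _ _ _ Hp) (main _ _ _ Hm) (main _ _ _ Ht).
  apply: filterS3 => w h1 h2 h3; apply: (ratio_of_sums_cvg Tmin0).
  - have E J : \sum_(0 <= k < J) (Rw k w - s * T k w) =
        \sum_(0 <= k < J) (0 + 1 * Rw k w + - s * T k w).
      by apply: eq_bigr => k _; ring.
    by under eq_fun do rewrite E.
  - have E J : \sum_(0 <= k < J) (s * T k w - Rw k w) =
        \sum_(0 <= k < J) (0 + -1 * Rw k w + s * T k w).
      by apply: eq_bigr => k _; ring.
    by under eq_fun do rewrite E.
  - have E J : \sum_(0 <= k < J) (Tmin - T k w) =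
        \sum_(0 <= k < J) (Tmin + 0 * Rw k w + -1 * T k w).
      by apply: eq_bigr => k _; ring.
    by under eq_fun do rewrite E.
split=> k z zi.
- apply: le_trans (gap k z zi); apply: le_trans (ler_norm _).
  rewrite le_eqVlt; apply/orP; left; apply/eqP.
  by apply: eq_Rintegral => w _; ring.
- have : - (\int[P]_w ((f k (z, S 0%N w)).2 - s * (f k (z, S 0%N w)).1)) <=
      Tmax * `|z - s|.
    by apply: (le_trans (ler_norm _)); rewrite normrN; exact: gap.
  rewrite -[X in X <= _ -> _]mulN1r -RintegralZl//; last first.
    apply: sq_integrable_integrable.
    have := sq_integrableD (sqf2 k z zi) (sq_integrableZ (- s) (sqf1 k z zi)).
    by under eq_fun do rewrite mulNr.
  apply: le_trans; rewrite le_eqVlt; apply/orP; left; apply/eqP.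
  by apply: eq_Rintegral => w _; ring.
(* Here the mean is at most [0] at every [z], since the mean duration is at least [Tmin]. *)
- apply: (@le_trans _ _ 0); last by rewrite mulr_ge0.
  have /andP[h _] := rule_fst_bounds iidS ub s_in (max_f k) zi.
  under eq_Rintegral do rewrite mul0r addr0 mulN1r.
  rewrite RintegralB//; last 2 first.
  - exact: integrable_cst_real.
  - exact: sq_integrable_integrable (sqf1 k z zi).
  by rewrite Rintegral_cst_probability subr_le0.
Qed.
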